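(* Let $G$ be a block (a connected graph with no cut vertex) with a standard ordering $e_1<e_2<\dots<e_q$, and let $k=q-p+1$ where $p=|V(G)|$. Suppose $G$ has a vertex $w$ of degree two such that the two edges containing $w$ are $e_k$ and $e_q$. Give $G\setminus e_q$ and $G/e_q$ the induced ordering $e_1<\dots<e_{q-1}$ (these induced orderings are standard). If $G\setminus e_q$ and $G/e_q$ have NBC bases with respect to their induced orderings, then $G$ has an NBC basis with respect to the ordering $e_1<\dots<e_q$.
   Context: Graphs are finite and may have loops and multiple edges. For a graph $G$ with $p$ vertices and $q$ edges put $k=q-p+1$. A total ordering $e_1<\dots<e_q$ of $E(G)$ is standard if $G$ is connected and the last $p-1$ edges $e_{k+1},\dots,e_q$ form a spanning tree $T$ of $G$. Work over $\mathbb{Z}_2$ with a variable $x_i$ for each edge $e_i$; for $S\subseteq E(G)$, $\mathbf{x}^S=\prod_{e_i\in S}x_i$. A circuit is the edge set of a cycle of $G$; its broken circuit is $\bar C=C\setminus\{\min C\}$. For each tree edge $e_j$ ($j>k$), $D_j$ is the set of edges with one endpoint in each component of $T-e_j$, and $\theta_j=\sum_{e_i\in D_j}x_i$. Let $I(G)$ be the ideal generated by all $\mathbf{x}^{\bar C}$ and $R(G)=\mathbb{Z}_2[x_1,\dots,x_q]/(I(G)+\langle\theta_j:k<j\le q\rangle)$. For $1\le i\le k$ let $C_i$ be the unique circuit of $T+e_i$ (the fundamental circuits); the other circuits are called non-fundamental. Let $d_j=j$ for $j\le k$ and $d_j=\min\{i: e_i\in D_j\}$ for $j>k$. For a circuit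 $C$ define the monomial $m_{\bar C}=x_i^{|\bar C_i|}$ if $C=C_i$ with $i\le k$, and $m_{\bar C}=\prod_{e_j\in\bar C}x_{d_j}$ if $C$ is non-fundamental. Let $\mathrm{Mon}(k)$ be the set of monomials in $x_1,\dots,x_k$, $U(G)$ the set of monomials in $\mathrm{Mon}(k)$ divisible by some $m_{\bar C}$, and $L(G)=\mathrm{Mon}(k)\setminus U(G)$. The graph $G$ has an NBC basis with respect to the given standard ordering if the images in $R(G)$ of the monomials in $L(G)$ are distinct and form a $\mathbb{Z}_2$-vector space basis of $R(G)$. *)

(* Defs.v *)
From HB Require Import structures.
From mathcomp Require Import all_boot all_order all_algebra.
From mathcomp Require Import generic_quotient ring_quotient.
From mathcomp Require Import mpoly.
From Stdlib Require Import ClassicalEpsilon.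

Set Implicit Arguments.
Unset Strict Implicit.
Unset Printing Implicit Defensive.

Import GRing.Theory.
Local Open Scope ring_scope.
Local Open Scope quotient_scope.

(* A finite multigraph (loops and multiple edges allowed) together with a     *)
(* total ordering of its q edges: the edges are the elements of 'I_q, and     *)
(* i : 'I_q stands for the edge written e_(i+1) in 1-based notation. The      *)
(* order of the two endpoints in [ends i] is irrelevant.                      *)
Record ograph (q : nat) := OGraph {
  vertex : finType;
  ends : 'I_q -> vertex * vertex
}.

Section OrderedGraph.
Variables (q : nat) (G : ograph q).
Local Notation V := (vertex G).
Local Notation E := 'I_q.

Definition joins (e : E) (x y : V) : bool :=
  (ends G e == (x, y)) || (ends G e == (y, x)).

Definition incident (e : E) (x : V) : bool :=
  ((ends G e).1 == x) || ((ends G e).2 == x).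

(* A loop contributes 2. *)
Definition degree (x : V) : nat :=
  (\sum_(e : E) (((ends G e).1 == x) + ((ends G e).2 == x)))%N.

Definition adj (S : {set E}) : rel V :=
  [rel x y | [exists e in S, joins e x y]].

Definition connects (S : {set E}) : bool :=
  (0 < #|V|)%N && [forall x : V, forall y : V, connect (adj S) x y].

Definition connected_graph : bool := connects setT.

(* A circuit is the edge set of a cycle v_0 e_0 v_1 e_1 ... e_(n-1) v_0 with  *)
(* n = #|C| >= 1, distinct vertices and distinct edges: n = 1 is a loop and   *)
(* n = 2 a pair of parallel edges.                                            *)
Definition circuit (C : {set E}) : bool :=
  (0 < #|C|)%N &&
  [exists v : {ffun 'I_#|C| -> V}, exists e : {ffun 'I_#|C| -> E},
     [&& injectiveb v, injectiveb e, [set e i | i : 'I_#|C|] == C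
       & [forall i, joins (e i) (v i) (v (ordS i))]]].

Definition spanning_tree (S : {set E}) : bool :=
  connects S && [forall C : {set E}, (C \subset S) ==> ~~ circuit C].

Definition cut_vertex (v : V) : bool :=
  [exists x : V, exists y : V,
     [&& x != v, y != v &
       ~~ connect [rel a b | [&& a != v, b != v & adj setT a b]] x y]].

Definition block : bool := connected_graph && [forall v : V, ~~ cut_vertex v].

(* k = q - p + 1; the truncated subtraction is exact for connected graphs. *)
Definition corank : nat := (q.+1 - #|V|)%N.

Definition tree_edges : {set E} := [set e : E | (corank <= e)%N].

Definition standard : bool := connected_graph && spanning_tree tree_edges.

Definition broken (C : {set E}) : {set E} :=
  C :\: [set e in C | [forall f in C, (e <= f)%N]].

(* D_j, for j a tree edge: T - e_j has exactly two components. *)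
Definition fund_cut (j : E) : {set E} :=
  [set i : E |
    ~~ connect (adj (tree_edges :\ j)) (ends G i).1 (ends G i).2].

Definition theta (j : E) : {mpoly 'F_2[q]} := \sum_(i in fund_cut j) 'X_i.

Definition xprod (S : {set E}) : {mpoly 'F_2[q]} := \prod_(i in S) 'X_i.

(* The ideal I(G) + < theta_j : k < j <= q >. *)
Definition in_nbc_ideal (f : {mpoly 'F_2[q]}) : Prop :=
  exists (a : {set E} -> {mpoly 'F_2[q]}) (b : E -> {mpoly 'F_2[q]}),
    f = \sum_(C : {set E} | circuit C) a C * xprod (broken C)
        + \sum_(j in tree_edges) b j * theta j.

Definition nbc_ideal : {pred {mpoly 'F_2[q]}} :=
  fun f => if excluded_middle_informative (in_nbc_ideal f) then true else false.

Lemma nbc_idealP f : reflect (in_nbc_ideal f) (f \in nbc_ideal).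
Proof.
rewrite unfold_in /nbc_ideal.
by case: excluded_middle_informative => h; constructor.
Qed.

Lemma nbc_ideal_mull g f : f \in nbc_ideal -> g * f \in nbc_ideal.
Proof.
move=> /nbc_idealP[a [b ->]]; apply/nbc_idealP.
exists (fun C => g * a C), (fun j => g * b j).
rewrite mulrDr !mulr_sumr; congr (_ + _);
  by apply: eq_bigr => i _; rewrite mulrA.
Qed.

Lemma nbc_ideal_zmod_closed : zmod_closed nbc_ideal.
Proof.
split=> [|f g /nbc_idealP[a [b ->]] /nbc_idealP[a' [b' ->]]]; apply/nbc_idealP.
  exists (fun=> 0), (fun=> 0).
  by rewrite !big1 ?addr0 // => i _; rewrite mul0r.
exists (fun C => a C - a' C), (fun j => b j - b' j).
rewrite opprD addrACA -!sumrB; congr (_ + _);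
  by apply: eq_bigr => i _; rewrite mulrBl.
Qed.

HB.instance Definition _ :=
  GRing.isZmodClosed.Build {mpoly 'F_2[q]} nbc_ideal nbc_ideal_zmod_closed.

(* R(G), with its Z_2-vector space structure. The library puts a ring         *)
(* structure on {ideal_quot _} only for proper ideals, and here R(G) = 0 as   *)
(* soon as G has a loop, so only the additive quotient is reused.             *)
Definition nbc_ring : Type := {ideal_quot nbc_ideal}.

HB.instance Definition _ := GRing.Zmodule.on nbc_ring.

Definition nbc_pi (f : {mpoly 'F_2[q]}) : nbc_ring :=
  \pi_({ideal_quot nbc_ideal}) f.

Lemma nbc_piE f g : (nbc_pi f = nbc_pi g) <-> (f - g \in nbc_ideal).
Proof.
rewrite /nbc_pi; split=> [/eqP|h]; last apply/eqP;
  by rewrite -Quotient.idealrBE.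
Qed.

Lemma nbc_piD f g : nbc_pi (f + g) = nbc_pi f + nbc_pi g.
Proof. exact: (raddfD (\pi_({ideal_quot nbc_ideal}))). Qed.

Definition nbc_scale (c : 'F_2) (r : nbc_ring) : nbc_ring :=
  nbc_pi (c *: repr r).

Lemma nbc_reprK (r : nbc_ring) : nbc_pi (repr r) = r.
Proof. exact: reprK. Qed.

Lemma nbc_piZ c f : nbc_pi (c *: f) = nbc_scale c (nbc_pi f).
Proof.
apply/nbc_piE; rewrite -scalerBr -mul_mpolyC; apply: nbc_ideal_mull.
by apply/nbc_piE; rewrite nbc_reprK.
Qed.

Lemma nbc_scaleA a b r : nbc_scale a (nbc_scale b r) = nbc_scale (a * b) r.
Proof. by rewrite -[r]nbc_reprK -!nbc_piZ scalerA. Qed.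

Lemma nbc_scale1 : left_id 1 nbc_scale.
Proof. by move=> r; rewrite -[r]nbc_reprK -nbc_piZ scale1r. Qed.

Lemma nbc_scaleDr : right_distributive nbc_scale +%R.
Proof.
move=> c r s; rewrite -[r]nbc_reprK -[s]nbc_reprK.
by rewrite -nbc_piD -!nbc_piZ -nbc_piD scalerDr.
Qed.

Lemma nbc_scaleDl r : {morph nbc_scale^~ r : a b / a + b}.
Proof.
by move=> a b; rewrite -[r]nbc_reprK -!nbc_piZ -nbc_piD scalerDl.
Qed.

HB.instance Definition _ := GRing.Zmodule_isLmodule.Build 'F_2 nbc_ring
  nbc_scaleA nbc_scale1 nbc_scaleDr nbc_scaleDl.

(* d_j; the default value j of the minimum belongs to D_j. *)
Definition dmin (j : E) : E :=
  if (j < corank)%N then j else [arg min_(i < j in fund_cut j) (i : nat)].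

(* C is the fundamental circuit C_i iff C is contained in T + e_i. *)
Definition fundamental (i : E) (C : {set E}) : bool :=
  [&& (i < corank)%N, circuit C & C \subset i |: tree_edges].

Definition mbar (C : {set E}) : 'X_{1..q} :=
  if [pick i | fundamental i C] is Some i then (U_(i) *+ #|broken C|)%MM
  else (\sum_(j in broken C) U_(dmin j))%MM.

Definition Monk : pred 'X_{1..q} :=
  [pred m : 'X_{1..q} | [forall i : E, (corank <= i)%N ==> (m i == 0%N)]].

Definition Uset : pred 'X_{1..q} :=
  [pred m : 'X_{1..q} | Monk m &&
    [exists C : {set E}, circuit C && (mbar C <= m)%MM]].

Definition Lset : pred 'X_{1..q} := [pred m : 'X_{1..q} | Monk m && ~~ Uset m].

End OrderedGraph.

(* The values f t, for t satisfying L, are distinct and form a basis of W. *)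
Definition distinct_basis (F : fieldType) (W : lmodType F) (T : eqType)
    (L : pred T) (f : T -> W) : Prop :=
  [/\ {in L &, injective f},
      forall (s : seq T) (c : T -> F), uniq s -> all L s ->
        \sum_(t <- s) c t *: f t = 0 -> forall t, t \in s -> c t = 0
    & forall w : W, exists (s : seq T) (c : T -> F),
        all L s /\ w = \sum_(t <- s) c t *: f t].

Definition has_NBC_basis (q : nat) (G : ograph q) : Prop :=
  distinct_basis (Lset G) (fun m => nbc_pi G 'X_[m]).

Section LastEdge.
Variables (q : nat) (G : ograph q.+1).
Local Notation V := (vertex G).
Local Notation u := (ends G ord_max).1.
Local Notation v := (ends G ord_max).2.

Definition delete_last : ograph q :=
  OGraph (fun i : 'I_q => ends G (widen_ord (leqnSn q) i)).

(* Contraction of the last edge uv: v is identified with u, which represents  *)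
(* the new vertex.                                                            *)
Definition contract_vertex : Type := {x : V | (x == u) || (x != v)}.
HB.instance Definition _ := Finite.on contract_vertex.

Lemma contract_subproof (x : V) (y := if x == v then u else x) :
  (y == u) || (y != v).
Proof. by rewrite /y; case: (eqVneq x v) => [_|->]; rewrite ?eqxx ?orbT. Qed.

Definition contract_map (x : V) : contract_vertex :=
  exist _ (if x == v then u else x) (contract_subproof x).

Definition contract_last : ograph q :=
  OGraph (fun i : 'I_q =>
    let e := ends G (widen_ord (leqnSn q) i) in
    (contract_map e.1, contract_map e.2)).

End LastEdge.

(* Main.v *)
Require Import Defs.
From HB Require Import structures.
From mathcomp Require Import all_boot all_order all_algebra.
From mathcomp Require Import generic_quotient ring mpoly.

(* Write H = G \ e_q and G' = G / e_q, and let P be the polynomial ring on the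
   first q - 1 edges. Since w has degree two, D_q = {e_k, e_q}, so x_q = x_k in
   R(G); moreover e_k is a bridge of H. Let A be the ideal of P generated by the
   broken circuits of H and the cut forms theta'_j of G'. Eliminating x_q turns
   J(G) into A + x_k J(G'), while J(H) = A + (x_k) and A is contained in J(G').
   Combinatorially L(G) is the disjoint union of L(H) and x_k L(G'), so it spans
   R(G) by right exactness of R(G') --x_k--> R(G) --> R(H) --> 0, and it is
   independent as soon as (A : x_k) = A.

   The latter says that x_k ends a regular sequence theta'_j, x_k on P / I(H),
   i.e. that the broken circuit complex is Cohen-Macaulay. Regularity on P / K
   follows from regularity on P / (K : x_e) and P / (K + x_e); taking the edges
   from the largest down reduces I(H) to ideals (x_b : b not in B) with B a
   spanning tree, modulo which the linear forms are linearly independent, hence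
   regular.

   Circuits are handled as minimal nonempty sets of edges of even degree
   everywhere, and connectivity through cuts. *)

Set Implicit Arguments.
Unset Strict Implicit.
Unset Printing Implicit Defensive.

Import GRing.Theory.
Local Open Scope ring_scope.

(** * Regular sequences *)

Section Ideals.
Variable R : comNzRingType.
Implicit Types (K S : R -> Prop) (f g t x : R) (s : seq R).

(** The obstacle is the left end of the sequence: a relation in R(G) among the monomials of x_k
    L(G') must come from one in R(G'). After the elimination an element of J(G) reads a + x_k b with
    a in A and b in J(G'); a relation x_k g of this form leaves x_k (g - b) in A, and regularity is
    there to cancel x_k. A is built from the circuits that avoid e_k, but with the forms of G'
    instead of those of H, so that it lies inside J(G') and still becomes J(H) when x_k is added.
    The passage between the three graphs is governed by w: putting w into a vertex set or taking it
    out changes whether e_k and e_q cross the set, and affects no other edge. *)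

Definition is_ideal K :=
  [/\ K 0, forall f g, K f -> K g -> K (f + g) & forall a f, K f -> K (a * f)].

Lemma ideal0 K : is_ideal K -> K 0. Proof. by case. Qed.

Lemma idealD K f g : is_ideal K -> K f -> K g -> K (f + g).
Proof. by case=> _ hD _; apply: hD. Qed.

Lemma idealM K a f : is_ideal K -> K f -> K (a * f).
Proof. by case=> _ _; apply. Qed.

Lemma idealN K f : is_ideal K -> K f -> K (- f).
Proof. by move=> idK; rewrite -mulN1r; apply: idealM. Qed.

Lemma idealB K f g : is_ideal K -> K f -> K g -> K (f - g).
Proof. by move=> idK Kf Kg; apply: idealD => //; apply: idealN. Qed.

Lemma ideal_sum K (I : Type) (r : seq I) (P : pred I) (F : I -> R) :
  is_ideal K -> (forall i, P i -> K (F i)) -> K (\sum_(i <- r | P i) F i).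
Proof.
move=> idK h; elim/big_ind: _ => //; first exact: ideal0.
by move=> f g; apply: idealD.
Qed.

Inductive igen S : R -> Prop :=
| igen_0 : igen S 0
| igen_D a g f : S g -> igen S f -> igen S (a * g + f).

Lemma igen_ideal S : is_ideal (igen S).
Proof.
split; first exact: igen_0.
- move=> f g; elim=> [|a h f' Sh _ IH] Kg; first by rewrite add0r.
  by rewrite -addrA; apply: igen_D => //; apply: IH.
- move=> a f; elim=> [|b h f' Sh _ IH]; first by rewrite mulr0; apply: igen_0.
  by rewrite mulrDr mulrA; apply: igen_D.
Qed.

Lemma igen_mem S g : S g -> igen S g.
Proof. by move=> Sg; rewrite -[g]mul1r -[_ * _]addr0; apply/igen_D/igen_0. Qed.

Lemma igen_min S K f : is_ideal K -> (forall g, S g -> K g) -> igen S f -> K f.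
Proof.
move=> idK h; elim=> [|a g f' Sg _ Kf]; first exact: ideal0.
by apply: idealD => //; apply: idealM => //; apply: h.
Qed.

(** The ideal K + (t). *)
Definition addid K t f := exists a, K (f - a * t).

Definition colon K x f := K (x * f).

Lemma addid_ideal K t : is_ideal K -> is_ideal (addid K t).
Proof.
move=> idK; split.
- by exists 0; rewrite mul0r subr0; apply: ideal0.
- move=> f g [a Ka] [b Kb]; exists (a + b).
  have -> : f + g - (a + b) * t = (f - a * t) + (g - b * t) by ring.
  exact: idealD.
- move=> c f [a Ka]; exists (c * a).
  have -> : c * f - c * a * t = c * (f - a * t) by ring.
  exact: idealM.
Qed.

Lemma addid_igen S t f :
  addid (igen S) t f <-> igen (fun g => S g \/ g = t) f.
Proof.
split=> [[a Ka]|].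
  rewrite -[f](subrK (a * t)); apply: idealD; first exact: igen_ideal.
    by apply: igen_min Ka; [exact: igen_ideal|move=> g Sg; apply: igen_mem; left].
  by apply: idealM; [exact: igen_ideal|apply: igen_mem; right].
apply: igen_min; first exact/addid_ideal/igen_ideal.
move=> g [Sg|->]; first by exists 0; rewrite mul0r subr0; apply: igen_mem.
by exists 1; rewrite mul1r subrr; apply: igen_0.
Qed.

(** The final quotient may be zero: the unit ideal has to count as regular, since contracting all
    edges of a broken circuit produces it. *)
Fixpoint regular K s : Prop :=
  if s is t :: s' then (forall f, K (t * f) -> K f) /\ regular (addid K t) s'
  else True.

Lemma regular_ext K K' s :
  (forall f, K f <-> K' f) -> regular K s -> regular K' s.
Proof.
elim: s K K' => //= t s IH K K' e [h1 h2]; split.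
  by move=> f /e/h1/e.
by apply: IH h2 => f; split=> -[a /e Ka]; exists a.
Qed.

Lemma regular_full K s : (forall f, K f) -> regular K s.
Proof. by elim: s K => //= t s IH K KT; split=> //; apply: IH => f; exists 0. Qed.

(* The exact sequence 0 -> R/(K:x) -> R/K -> R/(K+x) -> 0: regularity on both  *)
(* ends passes to the middle, and exactness survives modulo each element.      *)
Lemma regular_colon_add K x s : is_ideal K ->
  regular (colon K x) s -> regular (addid K x) s -> regular K s.
Proof.
elim: s K => //= t s IH K idK [nzc regc] [nza rega].
split.
  move=> f Ktf.
  have [g Kg] : addid K x f.
    by apply: nza; exists 0; rewrite mul0r subr0.
  have /nzc : colon K x (t * g).
    rewrite /colon; have -> : x * (t * g) = t * f - t * (f - g * x) by ring.
    by apply: idealB => //; apply: idealM.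
  rewrite /colon => Kxg; have -> : f = (f - g * x) + x * g by ring.
  exact: idealD.
apply: IH; first exact: addid_ideal.
  apply: regular_ext regc => g; rewrite /colon; split=> -[h Kh].
    exists (x * h); have -> : x * g - x * h * t = x * (g - h * t) by ring.
    exact: Kh.
  have [h' Kh'] : addid K x h.
    apply: nza; exists g.
    have -> : t * h - g * x = - (x * g - h * t) by ring.
    exact: idealN.
  exists h'; have -> : x * (g - h' * t) = (x * g - h * t) + t * (h - h' * x).
    by ring.
  by apply: idealD => //; apply: idealM.
apply: regular_ext rega => f; split.
  move=> [a [b Kab]]; exists b, a.
  by have -> : f - b * x - a * t = f - a * t - b * x by ring.
move=> [a [b Kab]]; exists b, a.
by have -> : f - b * t - a * x = f - a * x - b * t by ring.
Qed.

(** Moving the elements of s one by one among the generators leaves the cancellation property of the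
    last element. With t = x_k this is (A : x_k) = A. *)
Lemma regular_last S s t f : regular (igen S) (rcons s t) ->
  igen (fun g => S g \/ g \in s) (t * f) -> igen (fun g => S g \/ g \in s) f.
Proof.
elim: s S => [|u s IH] S /=.
  have e h : igen (fun g => S g \/ g \in [::]) h <-> igen S h.
    by split; apply: igen_min; try exact: igen_ideal;
      move=> g; [case=> //|]; move=> Sg; apply: igen_mem => //; left.
  by move=> [nz _] /e/nz/e.
move=> [_ reg].
have e h : igen (fun g => (S g \/ g = u) \/ g \in s) h <->
           igen (fun g => S g \/ g \in u :: s) h.
  split; apply: igen_min; try exact: igen_ideal; move=> g hg; apply: igen_mem.
    case: hg => [[|->]|gs]; [by left|by right; rewrite mem_head|right].
    by rewrite inE gs orbT.
  by case: hg; [left; left|rewrite inE => /orP[/eqP|]; [left; right|right]].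
move=> /e h; apply/e; apply: IH h.
by apply: regular_ext reg => g; apply: addid_igen.
Qed.

End Ideals.

(** * Monomial ideals and ideals of linear forms *)

Section Monomial.
Variables (n : nat) (F : fieldType).
Implicit Types (bad : 'X_{1..n} -> Prop) (f g : {mpoly F[n]}).

(** The span of the [bad] monomials, an ideal when [bad] is closed under multiples; colon by a
    variable and sum with a variable then act on the predicate alone. With [Lset] for [bad] it
    serves merely as a subspace. *)
Definition monid bad f := forall m, f@_m != 0 -> bad m.

Lemma monid_ideal bad :
  (forall m m', bad m -> bad (m + m')%MM) -> is_ideal (monid bad).
Proof.
move=> up; split=> [m|f g Kf Kg m|a f Kf m]; first by rewrite mcoeff0 eqxx.
  rewrite -mcoeff_msupp => /msuppD_le; rewrite mem_cat !mcoeff_msupp.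
  by case/orP; [apply: Kf|apply: Kg].
rewrite -mcoeff_msupp => /msuppM_le /allpairsP[[m1 m2] /= [_ h2 ->]].
by rewrite addmC; apply/up/Kf; rewrite -mcoeff_msupp.
Qed.

Lemma monid_ext bad bad' f :
  (forall m, bad m <-> bad' m) -> monid bad f <-> monid bad' f.
Proof. by move=> e; split=> h m /h /e. Qed.

Lemma colon_monid bad i f :
  colon (monid bad) 'X_i f <-> monid (fun m => bad (m + U_(i))%MM) f.
Proof.
rewrite /colon; split=> h m fm.
  by apply: h; rewrite mulrC addmC mcoeffMX.
have: m \in msupp ('X_i * f) by rewrite mcoeff_msupp.
rewrite mulrC (perm_mem (msuppMX _ _)) => /mapP[m' hm' ->].
by rewrite addmC; apply: h; rewrite -mcoeff_msupp.
Qed.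

(** The quotient g collects the monomials on which b fails, each divided by X_i. *)
Lemma mpoly_split_var i f (b : pred 'X_{1..n}) :
  (forall m, m \in msupp f -> ~~ b m -> m i != 0%N) ->
  exists g, forall m, (f - g * 'X_i)@_m != 0 -> (f@_m != 0) && b m.
Proof.
move=> h.
exists (\sum_(m <- msupp f | ~~ b m) f@_m *: 'X_[m - U_(i)]).
have -> : f - (\sum_(m <- msupp f | ~~ b m) f@_m *: 'X_[m - U_(i)]) * 'X_i =
          \sum_(m <- msupp f | b m) f@_m *: 'X_[m].
  apply/eqP; rewrite subr_eq {1}[f]mpolyE (bigID b) /=; apply/eqP.
  congr (_ + _); rewrite mulr_suml big_seq_cond [RHS]big_seq_cond.
  apply: eq_bigr => m /andP[mf nb]; rewrite -scalerAl -mpolyXD submK //.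
  by apply/mnm_lepP => j; rewrite mnmE; case: eqP => [<-|] //=; rewrite lt0n h.
move=> m; rewrite -mcoeff_msupp => /msupp_sum_le /flattenP[s].
case/mapP=> m'; rewrite mem_filter => /andP[bm' m'f ->] /msuppZ_le.
by rewrite msuppX inE => /eqP->; rewrite bm' andbT -mcoeff_msupp.
Qed.

Lemma addid_monid bad i f : (forall m m', bad m -> bad (m + m')%MM) ->
  addid (monid bad) 'X_i f <-> monid (fun m => bad m \/ m i != 0%N) f.
Proof.
move=> up; split=> [[a h]|h].
  have up' m m' : bad m \/ m i != 0%N -> bad (m + m')%MM \/ (m + m')%MM i != 0%N.
    by case=> [/up bm|mi]; [left; apply: bm|right; rewrite mnmE addn_eq0 negb_and mi].
  have idb : is_ideal (monid (fun m => bad m \/ m i != 0%N)).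
    exact: monid_ideal up'.
  rewrite -[f](subrK (a * 'X_i)); apply: (idealD idb).
    by move=> m /h; left.
  apply: (idealM _ idb).
  move=> m; rewrite mcoeffX; case: (eqVneq U_(i)%MM m) => [<-|]; last by rewrite eqxx.
  by rewrite mnmE eqxx; right.
have [|g hg] := @mpoly_split_var i f (fun m => m i == 0%N); first by [].
by exists g => m /hg/andP[/h[]// ni /eqP e]; rewrite e in ni.
Qed.

(** Agreement modulo K passes to products by ab - sg(a) sg(b) = a (b - sg b) + sg(b) (a - sg a), so
    it need only be tested on variables. *)
Lemma rmorph_sub_ideal (K : {mpoly F[n]} -> Prop)
    (sg : {rmorphism {mpoly F[n]} -> {mpoly F[n]}}) :
  is_ideal K -> (forall c, sg c%:MP = c%:MP) -> (forall i, K ('X_i - sg 'X_i)) ->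
  forall f, K (f - sg f).
Proof.
move=> idK sgC sgX f.
have hM a b : K (a - sg a) -> K (b - sg b) -> K (a * b - sg (a * b)).
  move=> ha hb; rewrite rmorphM.
  have -> : a * b - sg a * sg b = a * (b - sg b) + sg b * (a - sg a) by ring.
  by apply: idealD => //; apply: idealM.
have h1 : K (1 - sg 1) by rewrite rmorph1 subrr; apply: ideal0.
rewrite [f]mpolyE; elim/big_ind: _ => [|a b ha hb|m _].
- by rewrite rmorph0 subr0; apply: ideal0.
- by rewrite rmorphD opprD addrACA; apply: idealD.
rewrite -mul_mpolyC rmorphM sgC -mulrBr; apply: idealM => //.
rewrite mpolyXE_id; elim/big_ind: _ => [//|a b|i _]; first exact: hM.
by elim: (m i) => [//|k IH]; rewrite exprS; apply: hM.
Qed.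

Definition linform (v : 'rV[F]_n) : {mpoly F[n]} := \sum_i v 0 i *: 'X_i.

Lemma linform_is_linear : linear linform.
Proof.
move=> a u v; rewrite /linform scaler_sumr -big_split /=.
by apply: eq_bigr => i _; rewrite !mxE scalerDl scalerA.
Qed.
HB.instance Definition _ :=
  GRing.isLinear.Build F 'rV[F]_n {mpoly F[n]} _ linform linform_is_linear.

Lemma linform_delta i : linform (delta_mx 0 i) = 'X_i.
Proof.
rewrite /linform (bigD1 i) //= mxE !eqxx scale1r big1 ?addr0 // => j ji.
by rewrite mxE (negPf ji) andbF scale0r.
Qed.

Lemma linform_coef v i : (linform v)@_U_(i) = v 0 i.
Proof.
rewrite /linform raddf_sum (bigD1 i) //= mcoeffZ mcoeffXU eqxx mulr1.
by rewrite big1 ?addr0 // => j ji; rewrite mcoeffZ mcoeffXU (negPf ji) mulr0.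
Qed.

Lemma linform_inj : injective linform.
Proof.
move=> u v e; apply/rowP=> i; by rewrite -!linform_coef e.
Qed.

Definition linid (X : seq 'rV[F]_n) : {mpoly F[n]} -> Prop :=
  igen (fun g => exists2 v, v \in X & g = linform v).

(* A free family has dual functionals, so x - \sum_i u_i(x) X_i is a           *)
(* substitution whose kernel is the ideal of the X_i, which is thus prime.     *)
Lemma linid_nzdiv X v f : free (v :: X) ->
  linid X (linform v * f) -> linid X f.
Proof.
rewrite free_cons => /andP[vX fX].
pose Xt := in_tuple X.
(* [pr] kills X and moves every vector by an element of the span of X; the substitution [sg] acts on
   linear forms through it. *)
pose pr (u : 'rV[F]_n) := u - \sum_i coord Xt i u *: X`_i.
pose lq := [tuple linform (pr (delta_mx 0 i)) | i < n].
pose sg (g : {mpoly F[n]}) : {mpoly F[n]} := g \mPo lq.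
have prZ : linear pr.
  move=> a u w; rewrite /pr scalerBr addrACA -opprD; congr (_ - _).
  rewrite scaler_sumr -big_split; apply: eq_bigr => i _.
  by rewrite linearP scalerDl scalerA.
pose prL : {linear 'rV[F]_n -> 'rV[F]_n} :=
  HB.pack pr (GRing.isLinear.Build F _ _ _ pr prZ).
have sgl u : sg (linform u) = linform (pr u).
  rewrite /sg {1}/linform raddf_sum /= [in RHS](row_sum_delta u).
  rewrite -[pr _]/(prL _) !raddf_sum /=; apply: eq_bigr => i _.
  rewrite comp_mpolyZ comp_mpolyXU -tnth_nth tnth_mktuple.
  by rewrite -[pr (_ *: _)]/(prL (_ *: _)) !linearZ.
have pr0 u : u \in X -> pr u = 0.
  move=> /(nthP 0)[i lti <-]; rewrite /pr (bigD1 (Ordinal lti)) //=.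
  have h j : coord Xt j X`_i = (Ordinal lti == j)%:R.
    by have := @coord_free _ _ _ Xt (Ordinal lti) j fX; rewrite eq_sym.
  rewrite h eqxx scale1r big1 ?addr0 ?subrr // => j ji.
  by rewrite h eq_sym (negPf ji) scale0r.
have lin_of u : u \in <<X>>%VS -> linid X (linform u).
  move=> uX; rewrite (@coord_span _ _ _ Xt u uX) raddf_sum; apply: ideal_sum.
    exact: igen_ideal.
  move=> i _; rewrite /= linearZ /= -mul_mpolyC; apply: idealM; first exact: igen_ideal.
  by apply: igen_mem; exists X`_i => //; apply: mem_nth.
have sgD g h : sg (g + h) = sg g + sg h by exact: raddfD.
have sgM g h : sg (g * h) = sg g * sg h by exact: rmorphM.
have idX : is_ideal (linid X) by exact: igen_ideal.
have sub1 g : linid X (g - sg g).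
  apply: (rmorph_sub_ideal (sg := comp_mpoly lq)) => // [c|i].
    exact: comp_mpolyC.
  rewrite -linform_delta -[X in _ - X]/(sg _) sgl -raddfB; apply: lin_of.
  rewrite /pr opprB addrC subrK.
  by apply: memv_suml => i0 _; apply/memvZ/memv_span; exact: mem_nth.
have sg0 g : linid X g -> sg g = 0.
  elim=> [|a h f' [u uX ->] _ IH]; first by rewrite /sg comp_mpoly0.
  by rewrite sgD sgM sgl (pr0 _ uX) linear0 mulr0 add0r.
(* Polynomials over a field form a domain, so [sg (linform v)] or [sg f] vanishes; the former would
   place v in the span of X. *)
move=> /sg0 /eqP; rewrite sgM mulf_eq0 => /orP[|/eqP e]; last first.
  by have := sub1 f; rewrite e subr0.
rewrite sgl => /eqP e; have {e} : pr v = 0 by apply: linform_inj; rewrite linear0.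
move/eqP; rewrite subr_eq0 => /eqP e; case/negP: vX; rewrite e.
by apply: memv_suml => i0 _; apply/memvZ/memv_span; exact: mem_nth.
Qed.

Lemma linid_regular X L : free (X ++ L) -> regular (linid X) (map linform L).
Proof.
elim: L X => //= v L IH X fXL; split.
  move=> f; apply: linid_nzdiv.
  have : free (X ++ [:: v] ++ L) by [].
  rewrite catA => /catl_free; rewrite cats1.
  by rewrite (perm_free (Y := v :: X)) // perm_rcons.
have /IH : free (rcons X v ++ L) by rewrite cat_rcons.
apply: regular_ext => f; split=> h.
  apply/addid_igen; apply: igen_min h; first exact: igen_ideal.
  move=> g [u]; rewrite mem_rcons inE => /orP[/eqP->|uX] ->; apply: igen_mem.
    by right.
  by left; exists u.
move/addid_igen: h; apply: igen_min; first exact: igen_ideal.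
by move=> g [[u uX ->]|->]; apply: igen_mem; [exists u|exists v];
  rewrite ?mem_rcons ?inE ?uX ?orbT ?eqxx.
Qed.

(** Links two views of an ideal of variables: generated by linear forms, for regularity, and
    monomial, for the broken circuit ideals. *)
Lemma linid_deltaE (r : seq 'I_n) f :
  linid [seq delta_mx 0 i | i <- r] f <->
  monid (fun m => exists2 i, i \in r & m i != 0%N) f.
Proof.
split.
  apply: igen_min.
    apply: monid_ideal => m m' [i ir mi]; exists i => //.
    by rewrite mnmE addn_eq0 negb_and mi.
  move=> g [v /mapP[i ir ->]] -> m; rewrite linform_delta mcoeffX.
  case: (eqVneq U_(i)%MM m) => [<- _|]; last by rewrite eqxx.
  by exists i => //; rewrite mnmE eqxx.
move=> h; rewrite [f]mpolyE big_seq; apply: ideal_sum; first exact: igen_ideal.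
move=> m; rewrite mcoeff_msupp => /h[i ir mi].
rewrite -mul_mpolyC; apply: idealM; first exact: igen_ideal.
have -> : m = (m - U_(i) + U_(i))%MM.
  rewrite submK //; apply/mnm_lepP => j; rewrite mnmE.
  by case: eqP => [<-|] //=; rewrite lt0n.
rewrite mpolyXD; apply: idealM; first exact: igen_ideal.
apply: igen_mem; exists (delta_mx 0 i); rewrite ?linform_delta //.
exact: map_f.
Qed.

Lemma free_map (I : eqType) (W : vectType F) (r : seq I) (w : I -> W) :
  uniq r ->
  (forall c : I -> F,
     \sum_(i <- r) c i *: w i = 0 -> forall i, i \in r -> c i = 0) ->
  free (map w r).
Proof.
move=> ur h.
suff: free (map_tuple w (in_tuple r)) by [].
apply/freeP => k e i; have x0 : I by case: (r) i => [[]|x ? _].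
pose c x := if insub (index x r) is Some j then k j else 0.
have cE (j : 'I_(size r)) : c (nth x0 r j) = k j.
  by rewrite /c index_uniq // valK.
rewrite -cE; apply: h; last exact: mem_nth.
rewrite (big_nth x0) big_mkord -[RHS]e; apply: eq_bigr => j _.
by rewrite cE (nth_map x0).
Qed.

End Monomial.

(** * Cycles and cuts modulo 2 *)

Lemma big_addb_pred1 (I : finType) (P : pred I) (a : I) :
  \big[addb/false]_x (P x && (a == x)) = P a.
Proof.
rewrite (bigD1 a) //= eqxx andbT big1 ?addbF // => x xa.
by rewrite eq_sym (negPf xa) andbF.
Qed.

Lemma addb_imp (a b : bool) : (a -> b) -> (b -> a) -> a (+) b = false.
Proof. by case: a b => [] [] // h1 h2; [have := h1 isT|have := h2 isT]. Qed.

Local Notation symd A B := [set z | (z \in A) (+) (z \in B)].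

Section Parity.
Variables (q : nat) (G : ograph q).
Local Notation V := (vertex G).
Local Notation E := 'I_q.
Implicit Types (S C F : {set E}) (X Y : {set V}) (x y z : V) (e f i j : E).

Definition cross X e : bool := ((ends G e).1 \in X) (+) ((ends G e).2 \in X).

Definition cut_parity S X : bool :=
  \big[addb/false]_e ((e \in S) && cross X e).

(** The cycle space over Z_2. A loop crosses no vertex set, in accord with its contribution 2 to a
    degree. *)
Definition evenset S : Prop := forall x, cut_parity S [set x] = false.

(** X is a union of components of the graph with edge set S; unlike paths, such sets transfer easily
    to deletions and contractions. *)
Definition uncrossed S X : Prop := forall e, e \in S -> cross X e = false.

Lemma cross_symd X Y e : cross (symd X Y) e = cross X e (+) cross Y e.
Proof. by rewrite /cross !inE addbACA. Qed.

Lemma cross1 x e : cross [set x] e = ((ends G e).1 == x) (+) ((ends G e).2 == x).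
Proof. by rewrite /cross !inE. Qed.

Lemma joins_cross X e x y : joins e x y -> cross X e = (x \in X) (+) (y \in X).
Proof. by rewrite /cross => /orP[]/eqP-> //=; rewrite addbC. Qed.

Lemma joins_ends e : joins e (ends G e).1 (ends G e).2.
Proof. by rewrite /joins -surjective_pairing eqxx. Qed.

Lemma joins_sym e x y : joins (G := G) e x y = joins e y x.
Proof. exact: orbC. Qed.

Lemma cut_parity_symd S S' X :
  cut_parity (symd S S') X = cut_parity S X (+) cut_parity S' X.
Proof.
rewrite /cut_parity -big_split; apply: eq_bigr => e _.
by rewrite inE andb_addl.
Qed.

Lemma cut_parity1 e X : cut_parity [set e] X = cross X e.
Proof.
rewrite -(big_addb_pred1 (cross X) e); apply: eq_bigr => f _.
by rewrite inE andbC eq_sym.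
Qed.

(** Summing degrees over X counts the edges inside X twice, which leaves the edges of the cut. *)
Lemma cut_parity_sum S X :
  cut_parity S X = \big[addb/false]_x ((x \in X) && cut_parity S [set x]).
Proof.
rewrite /cut_parity.
under [RHS]eq_bigr do rewrite (big_distrr (times := andb) (plus := addb)) /=.
rewrite exchange_big /=; apply: eq_bigr => e _.
under eq_bigr do rewrite andbCA cross1 andb_addr andb_addr.
rewrite big_split /=.
have h (a : V) : \big[addb/false]_x ((e \in S) && ((x \in X) && (a == x))) =
          (e \in S) && (a \in X).
  under eq_bigr do rewrite andbA.
  exact: (big_addb_pred1 (fun x => (e \in S) && (x \in X))).
by rewrite !h -andb_addr.
Qed.

Lemma evenset_cut S X : evenset S -> cut_parity S X = false.
Proof.
by move=> evS; rewrite cut_parity_sum big1 // => x _; rewrite evS andbF.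
Qed.

Lemma evenset_cut_other S X j : evenset S -> j \in S -> cross X j ->
  exists2 i, i != j & (i \in S) && cross X i.
Proof.
move=> evS jS cj; have := evenset_cut X evS.
rewrite /cut_parity (bigD1 j) //= jS cj /= => h.
case: (pickP [pred i | (i != j) && ((i \in S) && cross X i)]) => [i /andP[]|none].
  by exists i.
by rewrite big1 // in h => i ij; have := none i; rewrite /= ij.
Qed.

(** Indexing by natural numbers keeps the ordinals of size [#|C|] out of the construction of
    cycles. *)
Lemma circuit_intro (n : nat) (v : nat -> V) (e : nat -> E) : (0 < n)%N ->
  (forall a b, (a < n)%N -> (b < n)%N -> v a = v b -> a = b) ->
  (forall a b, (a < n)%N -> (b < n)%N -> e a = e b -> a = b) ->
  (forall a, (a < n)%N -> joins (e a) (v a) (v a.+1)) -> v n = v 0%N ->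
  circuit G [set e a | a : 'I_n].
Proof.
move=> n0 injv inje je vn; set C := [set _ | _ in _].
have cC : #|C| = n.
  rewrite card_imset ?card_ord // => a b eab; apply/val_inj.
  exact: inje (ltn_ord a) (ltn_ord b) eab.
have ltC (a : 'I_#|C|) : (a < n)%N by rewrite -[X in (_ < X)%N]cC.
apply/andP; split; [by rewrite cC|apply/existsP].
exists [ffun a : 'I_#|C| => v a]; apply/existsP; exists [ffun a : 'I_#|C| => e a].
apply/and4P; split.
- by apply/injectiveP => a b; rewrite !ffunE => /injv h; apply/val_inj/h.
- by apply/injectiveP => a b; rewrite !ffunE => /inje h; apply/val_inj/h.
- apply/eqP/setP => f; apply/imsetP/imsetP => -[a _ ->].
    by exists (Ordinal (ltC a)); rewrite // ffunE.
  have ltaC : (a < #|C|)%N by rewrite cC.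
  by exists (Ordinal ltaC); rewrite // ffunE.
apply/forallP => a; rewrite !ffunE /=.
move: (nat_of_ord a) (ltC a) => {}a ltan.
have -> : v (a.+1 %% #|C|)%N = v a.+1; last exact: je.
move: ltan; rewrite cC.
rewrite leq_eqVlt => /predU1P[->|lta]; first by rewrite modnn vn.
by rewrite modn_small.
Qed.

(** Each vertex of the cycle meets only two consecutive edges of C, so an even subset with one of
    them has the next, and going round it has all. *)
Lemma circuit_minimal_even C : circuit G C ->
  [/\ C != set0, evenset C &
      forall S, S \subset C -> S != set0 -> evenset S -> S = C].
Proof.
rewrite /circuit; move: #|C| => n /andP[n0 /existsP[v /existsP[e]]].
case/and4P => /injectiveP injv /injectiveP inje /eqP eC /forallP je.
have parE S X : S \subset C -> cut_parity S X =
    \big[addb/false]_a ((e a \in S) && ((v a \in X) (+) (v (ordS a) \in X))).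
  move=> sSC; rewrite /cut_parity (bigID (mem C)) /= [X in _ (+) X]big1 ?addbF.
    rewrite -eC big_imset /=; last by move=> a b _ _; apply: inje.
    by apply: eq_bigr => a _; rewrite (joins_cross X (je a)).
  by move=> f fC; case: (boolP (f \in S)) => // /(subsetP sSC); rewrite (negPf fC).
have reS (F : 'I_n -> bool) :
    \big[addb/false]_a F (ordS a) = \big[addb/false]_a F a.
  by rewrite [RHS](reindex_inj (@ordS_inj _)).
split; first by apply/set0Pn; exists (e (Ordinal n0)); rewrite -eC imset_f.
  move=> x; rewrite parE //.
  rewrite (eq_bigr (fun a => (v a \in [set x]) (+) (v (ordS a) \in [set x])));
    last by move=> a _; rewrite -eC imset_f.
  by rewrite big_split /= (reS (fun a => v a \in [set x])) addbb.
move=> S sSC S0 evS.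
have stepS a : e a \in S -> e (ordS a) \in S.
  have := evS (v (ordS a)); rewrite parE //.
  under eq_bigr => b _ do rewrite !inE andb_addr !(inj_eq injv) (inj_eq (@ordS_inj _)).
  rewrite big_split /=.
  have h b0 : \big[addb/false]_b ((e b \in S) && (b == b0)) = (e b0 \in S).
    under eq_bigr do rewrite eq_sym; exact: (big_addb_pred1 (fun b => e b \in S)).
  by rewrite !h => + ea; rewrite ea; case: (_ \in S).
have /set0Pn[f fS] := S0.
have /imsetP[a0 _ fa0] : f \in [set e i | i : 'I_n].
  by rewrite eC (subsetP sSC).
have allS k (a : 'I_n) : (a : nat) = ((a0 + k) %% n)%N -> e a \in S.
  elim: k a => [|k IH] a ak.
    rewrite addn0 modn_small // in ak; by rewrite (val_inj ak) -fa0.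
  have lt : ((a0 + k) %% n < n)%N by rewrite ltn_mod.
  have := stepS _ (IH (Ordinal lt) erefl).
  suff -> : ordS (Ordinal lt) = a by [].
  by apply/val_inj; rewrite /= ak -addn1 modnDml addn1 addnS.
apply/eqP; rewrite eqEsubset sSC -eC; apply/subsetP => _ /imsetP[a _ ->].
(* This number of steps leads from a0 to a modulo n, whichever of the two comes first. *)
apply: (allS (n - a0 + a)%N); rewrite addnA subnKC; last exact: ltnW.
by rewrite modnDl modn_small.
Qed.

(** In an even set without loops, a walk that enters a vertex can leave it by another edge; the
    first return to a visited vertex closes a circuit. *)
Lemma evenset_sub_circuit S : evenset S -> S != set0 ->
  exists2 C, circuit G C & C \subset S.
Proof.
move=> evS S0; case: (pickP [pred e | (e \in S) && ((ends G e).1 == (ends G e).2)]).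
  move=> e /andP[eS /eqP ee].
  exists [set e | a : 'I_1]; last by apply/subsetP => _ /imsetP[_ _ ->].
  apply: (@circuit_intro 1 (fun=> (ends G e).1) (fun=> e)) => //.
  - by case=> // -[].
  - by case=> // -[].
  - by move=> a _; rewrite {2}ee joins_ends.
move=> noloop.
have cr x e : e \in S -> incident e x -> cross [set x] e.
  move=> eS; rewrite cross1 /incident; have := noloop e; rewrite /= eS /=.
  case: (ends G e) => a b /=.
  by case: (eqVneq a x) => [->|_]; case: (eqVneq b x).
have ex x e : e \in S -> incident e x ->
    exists f, [&& f != e, f \in S & incident f x].
  move=> eS ix; have [f fe /andP[fS cf]] := evenset_cut_other evS eS (cr _ _ eS ix).
  exists f; rewrite fe fS /incident; move: cf; rewrite cross1.
  by case: (_.1 == x); case: (_.2 == x).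
pose other e x := if (ends G e).1 == x then (ends G e).2 else (ends G e).1.
(* A state is a vertex with the edge by which it will be left. The default of [odflt] never occurs,
   by [ex]. *)
pose next (d : V * E) :=
  (other d.2 d.1,
   odflt d.2 [pick f | [&& f != d.2, f \in S & incident f (other d.2 d.1)]]).
have /set0Pn[e0 e0S] := S0.
pose d k := iter k next ((ends G e0).1, e0).
pose x k := (d k).1; pose e k := (d k).2.
have jo f y : incident f y -> joins f y (other f y) /\ incident f (other f y).
  rewrite /incident /joins /other; case: (ends G f) => a b /=.
  by case: (eqVneq a y) => [->|ay] /=; rewrite ?eqxx ?orbT // => /eqP->; rewrite !eqxx ?orbT.
have dS k : [/\ e k \in S & incident (e k) (x k)].
  elim: k => [|k [eS ik]]; first by rewrite /e /x /d /= e0S /incident eqxx.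
  have [_ io] := jo _ _ ik; rewrite /e /x /d /=.
  case: pickP => [f /and3P[_ fS fi] //|none].
  by have [f] := ex _ _ eS io; rewrite none.
have xS k : joins (e k) (x k) (x k.+1) by have [_ /jo[]] := dS k.
have eS k : e k.+1 != e k.
  have [eSk ik] := dS k; have [_ io] := jo _ _ ik.
  rewrite [e k.+1]/e /d /=; case: pickP => [f /and3P[]//|none].
  by have [f] := ex _ _ eSk io; rewrite none.
(* At time j the walk first revisits a vertex, so the vertices before j are distinct. *)
have [j [i ltij xij] minj] : exists2 j : nat, exists2 i : nat, (i < j)%N & x i = x j
    & forall j' i' : nat, (i' < j')%N -> x i' = x j' -> (j <= j')%N.
  pose P (j : nat) := [exists i : 'I_j, x i == x j].
  have exP : exists j : nat, P j.
    have /injectivePn[a [b ab xab]] : ~~ injectiveb (fun a : 'I_#|V|.+1 => x a).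
      by apply/injectiveP => /leq_card; rewrite card_ord ltnn.
    wlog ltab : a b ab xab / (a < b)%N.
      move=> W; case: (ltngtP a b) => [|/W|/val_inj /eqP]; [exact: W|..].
        by apply; rewrite // eq_sym.
      by rewrite (negPf ab).
    by exists b; apply/existsP; exists (Ordinal ltab); apply/eqP.
  have [j Pj minj] := ex_minnP exP.
  exists j; first by have /existsP[i /eqP xi] := Pj; exists i.
  move=> j' i' lt' x'; apply: minj; apply/existsP.
  by exists (Ordinal lt'); apply/eqP.
have injx a b : (a < j)%N -> (b < j)%N -> x a = x b -> a = b.
  move=> aj bj xab; case: (ltngtP a b) => // /minj.
    by move=> /(_ xab); rewrite leqNgt bj.
  by move=> /(_ (esym xab)); rewrite leqNgt aj.
(* An edge repeated at times a < b would force x_b = x_(a+1), because x_a and x_b differ; then b = a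
   + 1, although each step takes a new edge. *)
have inje a b : (a < b)%N -> (i <= a)%N -> (b < j)%N -> e a <> e b.
  move=> ab ia bj eab; have aj := ltn_trans ab bj.
  have := xS a; have := xS b; rewrite -eab /joins.
  have xab : x a != x b.
    by apply/eqP => /(injx _ _ aj bj) abE; rewrite abE ltnn in ab.
  have xb1 : x b = x a.+1 -> False.
    move=> /(injx _ _ bj (leq_ltn_trans ab bj)) bE.
    by have := eS a; rewrite -bE eab eqxx.
  move=> /orP[]/eqP-> /orP[]/eqP[].
  - by move=> xe; rewrite xe eqxx in xab.
  - by move=> /xb1.
  - by move=> _ /xb1.
  - by move=> _ xe; rewrite xe eqxx in xab.
exists [set e (i + a)%N | a : 'I_(j - i)]; last first.
  by apply/subsetP => _ /imsetP[a _ ->]; have [] := dS (i + a)%N.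
have ltj a : (a < j - i)%N -> (i + a < j)%N by rewrite ltn_subRL.
apply: (@circuit_intro _ (fun a => x (i + a)%N) (fun a => e (i + a)%N)).
- by rewrite subn_gt0.
- move=> a b /ltj ha /ltj hb /(injx _ _ ha hb) /eqP.
  by rewrite eqn_add2l => /eqP.
- move=> a b /ltj ha /ltj hb eab; case: (ltngtP a b) => // ab; exfalso.
    by apply: (inje (i + a)%N (i + b)%N) => //; rewrite ?ltn_add2l ?leq_addr.
  by apply: (inje (i + b)%N (i + a)%N) => //; rewrite ?ltn_add2l ?leq_addr.
- by move=> a _; rewrite addnS; apply: xS.
- by rewrite subnKC ?addn0 ?xij // ltnW.
Qed.

Lemma circuitP C : circuit G C <->
  [/\ C != set0, evenset C &
      forall S, S \subset C -> S != set0 -> evenset S -> S = C].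
Proof.
split=> [|[C0 evC minC]]; first exact: circuit_minimal_even.
have [C' cC' sC'C] := evenset_sub_circuit evC C0.
have [C'0 evC' _] := circuit_minimal_even cC'.
by rewrite -(minC C').
Qed.

Lemma circuit_even C : circuit G C -> evenset C.
Proof. by case/circuitP. Qed.

Lemma adj_sym S : ssrbool.symmetric (adj (G := G) S).
Proof.
move=> x y; apply/existsP/existsP => -[e /andP[eS je]]; exists e;
  by rewrite eS joins_sym.
Qed.

(** For the converse, the test set is the component of x. *)
Lemma connect_cut S x y : connect (adj (G := G) S) x y <->
  forall X, uncrossed S X -> x \in X -> y \in X.
Proof.
split=> [cxy X unX xX|h].
  rewrite -(@closed_connect _ (adj (G := G) S) (mem X) _ x y) // => a b.
  case/existsP => e /andP[eS /(joins_cross X)].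
  by rewrite (unX _ eS) /=; case: (a \in X); case: (b \in X).
have := h [set z | connect (adj S) x z]; rewrite !inE; apply=> //.
move=> e eS; rewrite /cross !inE; set a := (ends G e).1; set b := (ends G e).2.
have ab : adj S a b by apply/existsP; exists e; rewrite eS joins_ends.
have ba : adj S b a by rewrite adj_sym.
by apply: addb_imp => hc; apply: connect_trans hc _; apply: connect1.
Qed.

Lemma connectsP S : connects G S <->
  (0 < #|V|)%N /\ forall X, uncrossed S X -> forall x y, x \in X -> y \in X.
Proof.
rewrite /connects; split=> [/andP[-> /forallP h]|[-> h]]; [split=> //|].
  move=> X unX x y; have /forallP/(_ y)/connect_cut := h x; exact.
by apply/forallP => x; apply/forallP => y; apply/connect_cut => X /h; apply.
Qed.

Lemma connects_uncrossed S X e :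
  connects G S -> uncrossed S X -> cross X e = false.
Proof.
move=> /connectsP[_ h] /h {}h; rewrite /cross.
by apply: addb_imp; apply: h.
Qed.

(** F is the mod 2 sum of the edges of a walk; its boundary is x + y even if the walk repeats
    edges. *)
Lemma connect_path_set S x y : connect (adj (G := G) S) x y ->
  exists2 F : {set E}, F \subset S & forall X, cut_parity F X = (x \in X) (+) (y \in X).
Proof.
case/connectP => p; elim: p x => [|z p IH] x /=.
  move=> _ ->; exists set0; first exact: sub0set.
  by move=> X; rewrite addbb /cut_parity big1 // => e _; rewrite inE.
case/andP => /existsP[e /andP[eS je]] pz /(IH _ pz)[F sFS FX].
exists (symd F [set e]).
  apply/subsetP => f; rewrite !inE; case: eqP => [->|_] //.
  by rewrite addbF => /(subsetP sFS).
move=> X; rewrite cut_parity_symd FX cut_parity1 (joins_cross X je).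
by case: (x \in X); case: (y \in X); case: (z \in X).
Qed.

Lemma spanning_treeP S : spanning_tree G S <->
  connects G S /\ forall F, F \subset S -> evenset F -> F = set0.
Proof.
rewrite /spanning_tree; split=> [/andP[cS /forallP h]|[-> h]].
  split=> // F sFS evF; apply/eqP; apply: contraT => F0.
  have [C cC sCF] := evenset_sub_circuit evF F0.
  by have := h C; rewrite (subset_trans sCF sFS) cC.
apply/forallP => C; apply/implyP => sCS; apply/negP => /circuitP[C0 evC _].
by rewrite (h C) ?eqxx in C0.
Qed.

End Parity.

(** * Fundamental cuts of a standard ordering *)

Section StandardCuts.
Variables (q : nat) (G : ograph q).
Hypothesis stdG : standard G.
Local Notation T := (tree_edges G).
Local Notation D := (fund_cut G).

Lemma standard_tree : spanning_tree G T.
Proof. by case/andP: stdG. Qed.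

Lemma tree_connects : connects G T.
Proof. by have /spanning_treeP[] := standard_tree. Qed.

Lemma tree_acyclic (F : {set 'I_q}) : F \subset T -> evenset G F -> F = set0.
Proof. by have /spanning_treeP[_ h] := standard_tree; apply: h. Qed.

(** X can be taken as the component of an end of e_i in T - e_j. Being existential in X, this form
    of D_j carries over to other graphs. *)
Lemma fund_cut_exists (i j : 'I_q) :
  i \in D j <-> exists2 X : {set vertex G}, uncrossed (T :\ j) X & cross X i.
Proof.
rewrite inE; split=> [nc|[X unX]]; last first.
  apply: contraL => /connect_cut h.
  have /connect_cut h' : connect (adj (T :\ j)) (ends G i).2 (ends G i).1.
    by rewrite (sym_connect_sym (@adj_sym _ _ _)); apply/connect_cut.
  by apply/negbT/addb_imp; [apply: h|apply: h'].
exists [set z | connect (adj (T :\ j)) (ends G i).1 z].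
  move=> e eS; rewrite /cross !inE; set a := (ends G e).1; set b := (ends G e).2.
  have ab : adj (T :\ j) a b by apply/existsP; exists e; rewrite eS joins_ends.
  have ba : adj (T :\ j) b a by rewrite adj_sym.
  by apply: addb_imp => hc; apply: connect_trans hc _; apply: connect1.
by rewrite /cross !inE connect0 (negPf nc).
Qed.

(** Otherwise a path of T - e_j between the ends of e_j, together with e_j, would give a nonempty
    even set in T. *)
Lemma fund_cut_self (j : 'I_q) : j \in T -> j \in D j.
Proof.
move=> jT; rewrite inE; apply/negP => /connect_path_set[F sF FX].
have jF : j \notin F by apply/negP => /(subsetP sF); rewrite !inE eqxx.
have : j \in symd F [set j] by rewrite !inE (negPf jF) eqxx.
rewrite (@tree_acyclic (symd F [set j])) ?inE //.
  apply/subsetP => f; rewrite !inE; case: eqP => [->|_]; first by rewrite inE in jT.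
  by rewrite addbF => /(subsetP sF); rewrite !inE => /andP[].
by move=> x; rewrite cut_parity_symd FX cut_parity1 /cross addbb.
Qed.

(** If e_j is the only tree edge crossing X, and likewise for Y, then no tree edge crosses their
    symmetric difference, hence no edge does as T is connected: the cut does not depend on X. *)
Lemma fund_cut_cross (j : 'I_q) (X : {set vertex G}) :
  uncrossed (T :\ j) X -> cross X j -> D j = [set i | cross X i].
Proof.
move=> unX cX; apply/setP => i; rewrite [RHS]inE.
apply/idP/idP => [/fund_cut_exists[Y unY cY]|cXi]; last first.
  by apply/fund_cut_exists; exists X.
case: (boolP (cross Y j)) => cYj; last first.
  rewrite (connects_uncrossed i tree_connects) // in cY => e eT.
  by case: (eqVneq e j) => [->|ej]; [exact: negPf|apply: unY; rewrite !inE ej; rewrite inE in eT].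
have := @connects_uncrossed _ _ T (symd X Y) i tree_connects.
rewrite cross_symd cY addbT => h; apply: negbFE; apply: h => e eT.
rewrite cross_symd; case: (eqVneq e j) => [->|ej]; first by rewrite cX cYj.
by rewrite unX ?unY // !inE ej; rewrite inE in eT.
Qed.

Lemma fund_cut_coboundary (j : 'I_q) : j \in T -> exists X : {set vertex G},
  [/\ uncrossed (T :\ j) X, cross X j & D j = [set i | cross X i]].
Proof.
move=> jT; have /fund_cut_exists[X unX cX] := fund_cut_self jT.
by exists X; split=> //; apply: fund_cut_cross.
Qed.

Lemma fund_cut_tree (i j : 'I_q) : i \in T -> j \in T -> (i \in D j) = (i == j).
Proof.
move=> iT jT; case: (eqVneq i j) => [->|ij]; first exact: fund_cut_self.
apply/negbTE/negP => /fund_cut_exists[X unX]; rewrite unX // !inE ij.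
by rewrite inE in iT.
Qed.

End StandardCuts.

(** * The broken circuit ideal *)

Section BrokenCircuits.
Variables (q : nat) (G : ograph q).
Local Notation E := 'I_q.
Local Notation P := {mpoly 'F_2[q]}.
Implicit Types (A B C S : {set E}) (m : 'X_{1..q}).

Definition broken_gen (g : P) : Prop :=
  exists2 C, circuit G C & g = xprod (broken C).

Definition nbc_gen (g : P) : Prop :=
  broken_gen g \/ exists2 j, j \in tree_edges G & g = theta G j.

Lemma in_nbc_ideal_is_ideal : is_ideal (in_nbc_ideal G).
Proof.
have [h0 hB] := nbc_ideal_zmod_closed G.
split; first exact/nbc_idealP.
  move=> f g /nbc_idealP Kf /nbc_idealP Kg; apply/nbc_idealP.
  by have := hB _ _ Kf (hB _ _ h0 Kg); rewrite sub0r opprK.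
by move=> a f /nbc_idealP Kf; apply/nbc_idealP/nbc_ideal_mull.
Qed.

Lemma in_nbc_idealE f : in_nbc_ideal G f <-> igen nbc_gen f.
Proof.
split.
  case=> a [b ->]; apply: idealD; first exact: igen_ideal.
    apply: ideal_sum => [|C cC]; first exact: igen_ideal.
    apply: idealM; first exact: igen_ideal.
    by apply: igen_mem; left; exists C.
  apply: ideal_sum => [|j jT]; first exact: igen_ideal.
  apply: idealM; first exact: igen_ideal.
  by apply: igen_mem; right; exists j.
apply: igen_min; first exact: in_nbc_ideal_is_ideal.
move=> g [[C cC]|[j jT]] ->.
  exists (fun C' => (C' == C)%:R), (fun=> 0).
  rewrite [X in _ + X]big1 ?addr0; last by move=> i _; rewrite mul0r.
  rewrite (bigD1 C) //= eqxx mul1r big1 ?addr0 // => C' /andP[_ /negPf->].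
  by rewrite mul0r.
exists (fun=> 0), (fun j' => (j' == j)%:R).
rewrite big1 ?add0r; last by move=> i _; rewrite mul0r.
rewrite (bigD1 j) //= eqxx mul1r big1 ?addr0 // => j' /andP[_ /negPf->].
by rewrite mul0r.
Qed.

Lemma nbc_min (I : P -> Prop) f : is_ideal I ->
  (forall C, circuit G C -> I (xprod (broken C))) ->
  (forall j, j \in tree_edges G -> I (theta G j)) -> in_nbc_ideal G f -> I f.
Proof.
move=> idI hC hj /in_nbc_idealE; apply: igen_min => // g [[C cC ->]|[j jT ->]].
  exact: hC.
exact: hj.
Qed.

Lemma nbc_circuit C : circuit G C -> in_nbc_ideal G (xprod (broken C)).
Proof. by move=> cC; apply/in_nbc_idealE/igen_mem; left; exists C. Qed.

Lemma nbc_theta j : j \in tree_edges G -> in_nbc_ideal G (theta G j).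
Proof. by move=> jT; apply/in_nbc_idealE/igen_mem; right; exists j. Qed.

Lemma xprodE S : xprod S = 'X_[\sum_(i in S) U_(i)] :> P.
Proof. by rewrite (big_morph _ (@mpolyXD _ _) (@mpolyX0 _ _)). Qed.

Lemma mnm_sumU S i : (\sum_(j in S) U_(j))%MM i = (i \in S).
Proof.
rewrite mnm_sumE; case: (boolP (i \in S)) => iS; last first.
  apply: big1 => j jS; rewrite mnmE; case: eqP => // ji.
  by rewrite -ji jS in iS.
rewrite (bigD1 i) //= mnmE eqxx big1 // => j /andP[_ /negPf ji].
by rewrite mnmE ji.
Qed.

Lemma in_broken C e :
  (e \in broken C) = (e \in C) && ~~ [forall f in C, (e <= f)%N].
Proof. by rewrite in_setD in_set; case: (e \in C); rewrite ?andbT ?andbF. Qed.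

Lemma broken_sub C : broken C \subset C.
Proof. exact: subsetDl. Qed.

Lemma broken_minP C e : e \in broken C -> exists c,
  [/\ c \in C, (c < e)%N & forall f, f \in C -> f != c -> f \in broken C].
Proof.
rewrite in_broken => /andP[eC ne].
exists [arg min_(c < e in C) (c : nat)].
case: arg_minnP => // c cC minc; split=> //.
  move: ne => /forallPn[f]; rewrite negb_imply -ltnNge.
  by case/andP=> fC; apply: leq_ltn_trans; apply: minc.
move=> f fC fc; rewrite in_broken fC.
apply/forallPn; exists c; rewrite negb_imply cC /= -ltnNge.
by rewrite ltn_neqAle minc // andbT; apply: contra fc => /eqP/val_inj ->.
Qed.

(** A circuit never meets a cut in exactly one edge, so e is not the only edge of S in any cut. *)
Lemma connects_circuit_del S C e : connects G S -> circuit G C ->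
  C \subset S -> e \in C -> connects G (S :\ e).
Proof.
move=> cS cC sCS eC; have /connectsP[V0 hS] := cS.
apply/connectsP; split=> // X unX; apply: hS => f fS.
case: (eqVneq f e) => [->|fe]; last by apply: unX; rewrite !inE fe.
apply/negbTE/negP => cX.
have [i ie /andP[iC]] := evenset_cut_other (circuit_even cC) eC cX.
by rewrite unX // !inE ie (subsetP sCS).
Qed.

(* The squarefree monomials outside are the faces S, disjoint from B, with     *)
(* S :|: A containing no broken circuit: the ideal (I(G) : x^A) + (x_b, b in B). *)
Definition nbc_bad A B m : Prop :=
  (exists2 b, b \in B & m b != 0%N) \/
  (exists2 C, circuit G C & forall i, i \in broken C -> i \in A \/ m i != 0%N).

Lemma nbc_bad_up A B m m' : nbc_bad A B m -> nbc_bad A B (m + m')%MM.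
Proof.
have up i : m i != 0%N -> (m + m')%MM i != 0%N.
  by rewrite mnmE addn_eq0 negb_and => ->.
case=> [[b bB /up mb]|[C cC h]]; first by left; exists b.
by right; exists C => // i /h[iA|/up mi]; [left|right].
Qed.

(** The colon by x_e on the level of monomials; as e is outside B, the new factor x_e meets none of
    the conditions coming from B. *)
Lemma nbc_bad_addU A B e m : e \notin B ->
  nbc_bad (e |: A) B m <-> nbc_bad A B (m + U_(e))%MM.
Proof.
move=> eB; split=> [[[b bB mb]|[C cC h]]|[[b bB]|[C cC h]]].
- by left; exists b; rewrite // mnmE addn_eq0 negb_and mb.
- right; exists C => // i /h; rewrite !inE mnmE.
  case=> [/predU1P[->|]|mi]; [right|by left|right].
    by rewrite mnmE eqxx addn1.
  by rewrite addn_eq0 negb_and mi.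
- rewrite mnmE mnmE; case: (eqVneq e b) => [eb|_]; last first.
    by rewrite addn0; left; exists b.
  by rewrite -eb (negPf eB) in bB.
- right; exists C => // i /h; rewrite !inE mnmE mnmE.
  case=> [->|]; first by left; rewrite orbT.
  by case: (eqVneq e i) => [_|_]; [left|rewrite addn0; right].
Qed.

Lemma broken_ideal_monid f :
  igen broken_gen f <-> monid (nbc_bad set0 set0) f.
Proof.
split.
  apply: igen_min; first exact/monid_ideal/nbc_bad_up.
  move=> g [C cC ->] m; rewrite xprodE mcoeffX; set m0 := (\sum_(i in _) _)%MM.
  case: (eqVneq m0 m) => [<- _|]; last by rewrite eqxx.
  by right; exists C => // i iC; right; rewrite mnm_sumU iC.
move=> h; rewrite [f]mpolyE big_seq; apply: ideal_sum; first exact: igen_ideal.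
move=> m; rewrite mcoeff_msupp => /h[[b]|[C cC hC]]; first by rewrite inE.
rewrite -mul_mpolyC; apply: idealM; first exact: igen_ideal.
have -> : m = (m - \sum_(i in broken C) U_(i) + \sum_(i in broken C) U_(i))%MM.
  rewrite submK //; apply/mnm_lepP => j; rewrite mnm_sumU.
  by case: (boolP (j \in _)) => // /hC[]; rewrite ?inE // -lt0n.
rewrite mpolyXD -xprodE; apply: idealM; first exact: igen_ideal.
by apply: igen_mem; exists C.
Qed.

Section Regular.
Variable s : seq P.
(** For cut forms this will hold because a nonempty cut has an edge in every A that connects G. *)
Hypothesis leaf : forall A, connects G A ->
  regular (monid (fun m => exists2 b, b \in ~: A & m b != 0%N)) s.

(* Edges are moved one by one, the largest first, into A or B, keeping the     *)
(* complement of B connected; an edge e that cannot be deleted is a cone point *)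
(* of the remaining complex, so that contracting it does not change the ideal. *)
Lemma nbc_minor_regular n A B : (n <= q)%N ->
  (forall i, (i \in A) || (i \in B) = (n <= i)%N) ->
  (forall i, i \in A -> i \notin B) -> connects G (~: B) ->
  regular (monid (nbc_bad A B)) s.
Proof.
elim: n A B => [|n IH] A B nq AB disj cB.
  have defA : A = ~: B.
    apply/setP => i; rewrite inE; have := AB i; have := disj i.
    by case: (i \in A); case: (i \in B) => //= /(_ isT).
  (* All edges are placed. A broken circuit inside A makes this the unit ideal; otherwise only the
     variables of B remain. *)
  case: (pickP [pred C | circuit G C && (broken C \subset A)]) => [C|none].
    case/andP=> cC /subsetP sCA; apply: regular_full => f m _.
    by right; exists C => // i /sCA; left.
  have := leaf cB; apply: regular_ext => f; apply: monid_ext => m.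
  rewrite setCK; split=> [|[//|[C cC h]]]; first by left.
  have /negP nsub := none C; rewrite /= cC /= in nsub.
  have /subsetPn[i iC iA] : ~~ (broken C \subset A) by apply/negP.
  exists i; last by case: (h i iC) => // iA'; rewrite iA' in iA.
  by move: iA; rewrite defA inE negbK.
pose e := Ordinal nq.
have eA : e \notin A by have := AB e; rewrite /= ltnn; case: (e \in A).
have eB : e \notin B by have := AB e; rewrite /= ltnn orbC; case: (e \in B).
have le_n (i : E) : (i == e) || (n < i)%N = (n <= i)%N.
  by rewrite [RHS]leq_eqVlt eq_sym -val_eqE.
have regA : regular (monid (nbc_bad (e |: A) B)) s.
  apply: IH => //; first exact: ltnW.
    by move=> i; rewrite !inE -orbA AB le_n.
  by move=> i; rewrite !inE => /predU1P[->|/disj].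
case: (boolP (connects G (~: (e |: B)))) => conB; last first.
  apply: regular_ext regA => p; apply: monid_ext => m; split; last first.
    case=> [|[C cC h]]; [by left|right; exists C => // i /h].
    by rewrite inE; case=> [->|]; [left; rewrite orbT|right].
  case=> [|[C cC h]]; first by left.
  case: (boolP [exists b in B, m b != 0%N]) => [/existsP[b /andP[bB mb]]|noB].
    by left; exists b.
  right; exists C => // i iC; case: (h i iC) => [|]; last by right.
  rewrite !inE => /predU1P[ie|]; last by left.
  (* The minimum c of C is smaller than e, so not yet in B, and the other edges of C avoid B too.
     Thus C is a circuit through e in the complement of B, and deleting e keeps that complement
     connected. This is why the largest edge goes first. *)
  exfalso; case/negP: conB; rewrite ie in iC.
  have -> : ~: (e |: B) = ~: B :\ e.
    by apply/setP => f; rewrite !inE negb_or.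
  apply: (connects_circuit_del cB cC); last exact: (subsetP (broken_sub C)).
  have [c [cC' ce hc]] := broken_minP iC.
  apply/subsetP => f fC; rewrite inE; case: (eqVneq f c) => [->|fc].
    apply/negP => cB'; have := AB c; rewrite cB' orbT => /esym.
    by rewrite ltnNge (ltnW ce).
  case: (h f (hc f fC fc)) => [|mf].
    by rewrite !inE => /predU1P[->|/disj].
  by apply/negP => fB; case/negP: noB; apply/existsP; exists f; rewrite fB.
have idB : is_ideal (monid (F := 'F_2) (nbc_bad A B)).
  exact/monid_ideal/nbc_bad_up.
(* The colon by x_e puts e into A, the sum with x_e puts it into B. *)
apply: (@regular_colon_add _ _ 'X_e) => //.
  apply: regular_ext regA => f; rewrite colon_monid.
  by apply: monid_ext => m; apply: nbc_bad_addU.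
have : regular (monid (nbc_bad A (e |: B))) s.
  apply: IH => //; first exact: ltnW.
    by move=> i; rewrite !inE orbCA AB le_n.
  move=> i iA; rewrite !inE negb_or disj // andbT.
  by apply: contraNneq eA => <-.
apply: regular_ext => f; split=> [h|/(addid_monid _ _ (@nbc_bad_up A B)) h].
  apply/addid_monid; first exact: nbc_bad_up.
  move=> m /h[[b]|]; last by left; right.
  by rewrite !inE => /predU1P[->|bB mb]; [right|left; left; exists b].
move=> m /h[[[b bB mb]|]|me]; [|by right|]; left.
  by exists b; rewrite // !inE bB orbT.
by exists e; rewrite // !inE eqxx.
Qed.

Lemma nbc_regular : connected_graph G -> regular (igen broken_gen) s.
Proof.
move=> conG.
have : regular (monid (nbc_bad set0 set0)) s.
  apply: (@nbc_minor_regular q) => //.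
  - by move=> i; rewrite !inE leqNgt ltn_ord.
  - by move=> i; rewrite inE.
  - by rewrite setC0.
by apply: regular_ext => f; rewrite broken_ideal_monid.
Qed.

End Regular.

End BrokenCircuits.

(** * Cut forms *)

Lemma F2P (c : 'F_2) : c = (c != 0)%:R.
Proof. by apply/val_inj; case: c => [[|[|]]]. Qed.

Lemma natr_addb (a b : bool) : (a (+) b)%:R = a%:R + b%:R :> 'F_2.
Proof. by apply/val_inj; case: a b => [] []. Qed.

Lemma mpolyF2_addrr n (f : {mpoly 'F_2[n]}) : f + f = 0.
Proof.
by rewrite -[f]scale1r -scalerDl (_ : 1 + 1 = 0) ?scale0r //; apply/val_inj.
Qed.

Section CutForms.
Variables (q : nat) (G : ograph q).
Hypothesis stdG : standard G.
Local Notation T := (tree_edges G).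

Definition indrow (S : {set 'I_q}) : 'rV['F_2]_q := \row_i (i \in S)%:R.

Lemma linform_indrow S : linform (indrow S) = \sum_(i in S) 'X_i.
Proof.
rewrite /linform [RHS]big_mkcond; apply: eq_bigr => i _; rewrite mxE.
by case: (i \in S); rewrite ?scale1r ?scale0r.
Qed.

(** Over Z_2 a combination of cuts is the cut of some vertex set X. If it misses A it is empty, and
    its coefficient at the tree edge e_j is c_j, since D_j is the only fundamental cut containing
    e_j. *)
Lemma cut_combination_vanish (A : {set 'I_q}) (c : 'I_q -> 'F_2) :
  connects G A ->
  (forall i, i \in A -> (\sum_(j in T) c j *: indrow (fund_cut G j)) 0 i = 0) ->
  forall j, j \in T -> c j = 0.
Proof.
move=> cA; set v := \sum_(j in _) _ => vA.
have [X vX] : exists X : {set vertex G}, forall i, v 0 i = (cross X i)%:R.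
  rewrite /v; elim/big_ind: _ => [|x y [X hX] [Y hY]|j jT].
  - by exists set0 => i; rewrite mxE /cross !inE.
  - by exists (symd X Y) => i; rewrite mxE cross_symd natr_addb hX hY.
  have [X [_ _ DX]] := fund_cut_coboundary stdG jT.
  rewrite [c j]F2P; case: (c j != 0).
    by exists X => i; rewrite scale1r mxE DX inE.
  by exists set0 => i; rewrite scale0r mxE /cross !inE.
have unX : uncrossed A X.
  move=> i /vA; rewrite vX; by case: (cross X i).
move=> j jT; have := vX j; rewrite (connects_uncrossed j cA unX) /v summxE.
rewrite (bigD1 j) //= !mxE (fund_cut_tree stdG) // eqxx mulr1 big1 ?addr0 //.
move=> i /andP[iT ij]; rewrite !mxE (fund_cut_tree stdG) //.
by rewrite eq_sym (negPf ij) mulr0.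
Qed.

(** Allows each cut form to be altered by a multiple of x_k, where e_k is a bridge and x_k itself is
    in the family. The forms of G' arise in this way from those of H. *)
Lemma cut_forms_free (A : {set 'I_q}) (k : 'I_q) (r : seq 'I_q)
    (F : 'I_q -> 'rV['F_2]_q) (a : 'I_q -> 'F_2) :
  connects G A -> uniq r -> r =i T -> k \in T -> fund_cut G k = [set k] ->
  F k = delta_mx 0 k ->
  (forall j, j \in T -> j != k -> F j = indrow (fund_cut G j) + a j *: delta_mx 0 k) ->
  free ([seq delta_mx 0 b | b <- enum (~: A)] ++ map F r).
Proof.
move=> cA ur rT kT Dk Fk Fj.
pose w (t : 'I_q + 'I_q) := match t with inl b => delta_mx 0 b | inr j => F j end.
have -> : [seq delta_mx 0 b | b <- enum (~: A)] ++ map F r =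
          map w (map inl (enum (~: A)) ++ map inr r).
  by rewrite map_cat -!map_comp.
apply: free_map.
  rewrite cat_uniq !map_inj_uniq ?enum_uniq ?ur ?andbT //=; try by move=> x y [].
  by apply/hasPn => _ /mapP[j _ ->]; apply/negP => /mapP[].
move=> c; rewrite big_cat !big_map /=.
rewrite [X in _ + X](perm_big (enum T)) /=; last first.
  by apply: uniq_perm; rewrite ?enum_uniq // => i; rewrite mem_enum rT.
rewrite !big_enum /= => e.
(* Collect at k the multiples of x_k brought in by the other forms, to get a combination of the
   unaltered cuts. *)
pose c' j := if j == k then c (inr k) + \sum_(j in T | j != k) c (inr j) * a j
             else c (inr j).
have indk : indrow [set k] = delta_mx 0 k.
  by apply/rowP => i; rewrite !mxE inE.
have eT : \sum_(j in T) c (inr j) *: F j =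
          \sum_(j in T) c' j *: indrow (fund_cut G j).
  rewrite (bigD1 k) //= [RHS](bigD1 k) //= Fk Dk indk {1}/c' eqxx scalerDl.
  rewrite -addrA; congr (_ + _); rewrite scaler_suml -big_split /=.
  apply: eq_bigr => j /andP[jT jk]; rewrite Fj // /c' (negPf jk) scalerDr scalerA.
  by rewrite addrC.
rewrite eT in e.
have vA i : i \in A -> (\sum_(j in T) c' j *: indrow (fund_cut G j)) 0 i = 0.
  move=> iA; have /rowP/(_ i) := e; rewrite !mxE => h; rewrite -[RHS]h.
  rewrite -[LHS]add0r; congr (_ + _); rewrite summxE big1 // => b.
  rewrite inE => bA; rewrite !mxE; case: (eqVneq i b) => [ib|_]; last by rewrite andbF mulr0.
  by rewrite -ib iA in bA.
have c'0 := cut_combination_vanish cA vA.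
have c0 j : j \in T -> j != k -> c (inr j) = 0.
  by move=> jT jk; have := c'0 j jT; rewrite /c' (negPf jk).
have ck : c (inr k) = 0.
  have := c'0 k kT; rewrite /c' eqxx big1 ?addr0 // => j /andP[jT jk].
  by rewrite c0 // mul0r.
move=> t; rewrite mem_cat => /orP[] /mapP[x xr ->]; last first.
  by case: (eqVneq x k) => [-> //|xk]; apply: c0 => //; rewrite -rT.
have /rowP/(_ x) := e; rewrite [X in _ + X]big1 ?addr0; last first.
  by move=> j jT; rewrite c'0 // scale0r.
rewrite mem_enum in xr.
rewrite summxE mxE (bigD1 x) //= !mxE !eqxx mulr1 big1 ?addr0 // => b.
by case/andP=> _ bx; rewrite !mxE eqxx /= eq_sym (negPf bx) mulr0.
Qed.

End CutForms.

(** * Deletion and contraction at a vertex of degree two *)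

Lemma connects_mono q (G : ograph q) (S S' : {set 'I_q}) :
  S \subset S' -> connects G S -> connects G S'.
Proof.
move=> sSS' /connectsP[V0 h]; apply/connectsP; split=> // X unX.
by apply: h => e eS; apply: unX; apply: (subsetP sSS').
Qed.

Lemma standard_of_tree q (G : ograph q) :
  spanning_tree G (tree_edges G) -> standard G.
Proof.
move=> tT; rewrite /standard tT andbT; have /spanning_treeP[cT _] := tT.
exact: connects_mono (subsetT _) cT.
Qed.

Lemma cut_parity_symdr q (G : ograph q) (S : {set 'I_q}) (X Y : {set vertex G}) :
  cut_parity S (symd X Y) = cut_parity S X (+) cut_parity S Y.
Proof.
rewrite /cut_parity -big_split; apply: eq_bigr => e _.
by rewrite cross_symd andb_addr.
Qed.

(** * Fundamental circuits, the indices d_j and the monomials of L(G) *)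

Section StandardMonomials.
Variables (q : nat) (G : ograph q).
Hypothesis stdG : standard G.
Local Notation T := (tree_edges G).

Lemma circuit_not_tree (C : {set 'I_q}) : circuit G C -> ~~ (C \subset T).
Proof.
move=> /circuitP[C0 evC _]; apply: contra C0 => /(tree_acyclic stdG) h.
by rewrite h.
Qed.

(** Leaves no choice to the [pick] in [mbar]: two distinct indices would put C inside the tree. *)
Lemma fundamental_uniq (i i' : 'I_q) (C : {set 'I_q}) :
  fundamental G i C -> fundamental G i' C -> i = i'.
Proof.
case/and3P=> _ cC /subsetP sC /and3P[_ _ /subsetP sC'].
apply/eqP; apply: contraT => ii'; case/negP: (circuit_not_tree cC).
apply/subsetP => f fC; have := sC f fC; have := sC' f fC; rewrite !in_setU1.
case: (eqVneq f i) => [->|_] //=; by rewrite (negPf ii').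
Qed.

Lemma mbar_fund (i : 'I_q) (C : {set 'I_q}) :
  fundamental G i C -> mbar G C = (U_(i) *+ #|broken C|)%MM.
Proof.
move=> fC; rewrite /mbar; case: pickP => [i' fC'|none].
  by rewrite (fundamental_uniq fC' fC).
by rewrite none in fC.
Qed.

Lemma mbar_nonfund (C : {set 'I_q}) : (forall i, ~~ fundamental G i C) ->
  mbar G C = (\sum_(j in broken C) U_(dmin G j))%MM.
Proof.
move=> nf; rewrite /mbar; case: pickP => // i fC.
by have := nf i; rewrite fC.
Qed.

Lemma dmin_small (j : 'I_q) : j \notin T -> dmin G j = j.
Proof. by rewrite inE -ltnNge /dmin => ->. Qed.

Lemma dminP (j : 'I_q) : j \in T ->
  dmin G j \in fund_cut G j /\ forall i, i \in fund_cut G j -> (dmin G j <= i)%N.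
Proof.
move=> jT; rewrite /dmin ifF; last by rewrite inE in jT; rewrite ltnNge jT.
by case: arg_minnP => [|d dD dmin]; [exact: fund_cut_self|split].
Qed.

Lemma dmin_eq (j d : 'I_q) : j \in T -> d \in fund_cut G j ->
  (forall i, i \in fund_cut G j -> (d <= i)%N) -> dmin G j = d.
Proof.
move=> /dminP[jD minj] dD mind; apply/val_inj/eqP.
by rewrite eqn_leq minj // mind.
Qed.

Lemma LsetE (m : 'X_{1..q}) : Lset G m =
  Monk G m && ~~ [exists C : {set 'I_q}, circuit G C && (mbar G C <= m)%MM].
Proof. by rewrite /Lset /Uset /= ; case: (Monk G m). Qed.

Lemma MonkP (m : 'X_{1..q}) :
  reflect (forall i, i \in T -> m i = 0%N) (Monk G m).
Proof.
apply: (iffP forallP) => h i; first by rewrite inE => ci; apply/eqP; have /implyP := h i; apply.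
by apply/implyP => ci; rewrite h // inE.
Qed.

End StandardMonomials.

(** * NBC bases in terms of polynomials *)

Section Basis.
Variables (q : nat) (G : ograph q).

Lemma nbc_pi_sum (s : seq 'X_{1..q}) (c : 'X_{1..q} -> 'F_2) :
  nbc_pi G (\sum_(t <- s) c t *: 'X_[t]) = \sum_(t <- s) c t *: nbc_pi G 'X_[t].
Proof.
elim: s => [|t s IH]; last by rewrite !big_cons nbc_piD nbc_piZ IH.
rewrite !big_nil; apply: (addrI (nbc_pi G 0)).
by rewrite -nbc_piD !addr0.
Qed.

Lemma nbc_pi_eq0 (f : {mpoly 'F_2[q]}) : nbc_pi G f = 0 <-> in_nbc_ideal G f.
Proof.
have <- : nbc_pi G 0 = 0 by have := nbc_pi_sum [::] (fun=> 0); rewrite !big_nil.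
by split=> [/nbc_piE|h]; [|apply/nbc_piE]; rewrite subr0; [move/nbc_idealP|apply/nbc_idealP].
Qed.

(** Polynomials with monomials in L(G) replace finite families of coefficients. Distinctness of the
    images follows from independence: if m and m' had equal images, m + m' would map to zero. *)
Lemma has_NBC_basisP : has_NBC_basis G <->
  (forall f : {mpoly 'F_2[q]}, monid (Lset G) f -> in_nbc_ideal G f -> f = 0) /\
  (forall f : {mpoly 'F_2[q]}, exists2 g : {mpoly 'F_2[q]},
     monid (Lset G) g & in_nbc_ideal G (f - g)).
Proof.
have supp_sum s (c : 'X_{1..q} -> 'F_2) : all (Lset G) s ->
    monid (Lset G) (\sum_(t <- s) c t *: 'X_[t]).
  move=> /allP Ls m; rewrite -mcoeff_msupp => /msupp_sum_le /flattenP[l].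
  case/mapP=> t; rewrite filter_predT => ts -> /msuppZ_le.
  by rewrite msuppX inE => /eqP->; apply: Ls.
have supp_all (f : {mpoly 'F_2[q]}) : monid (Lset G) f -> all (Lset G) (msupp f).
  by move=> Lf; apply/allP => m; rewrite mcoeff_msupp; apply: Lf.
split=> [[_ ind span]|[ind span]].
  split=> [f Lf If|f].
    apply/mpolyP => m; rewrite mcoeff0; apply/eqP; rewrite mcoeff_eq0.
    apply/negP => mf; have := mf; rewrite mcoeff_msupp => /eqP; apply.
    apply: (ind (msupp f) (fun m => f@_m)) mf => //; first exact: supp_all.
    by rewrite -nbc_pi_sum -mpolyE; apply/nbc_pi_eq0.
  have [s [c [Ls ws]]] := span (nbc_pi G f).
  exists (\sum_(t <- s) c t *: 'X_[t]); first exact: supp_sum.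
  by apply/nbc_idealP/nbc_piE; rewrite nbc_pi_sum.
have indX s (c : 'X_{1..q} -> 'F_2) : uniq s -> all (Lset G) s ->
    \sum_(t <- s) c t *: nbc_pi G 'X_[t] = 0 -> forall t, t \in s -> c t = 0.
  move=> us Ls; rewrite -nbc_pi_sum => /nbc_pi_eq0 /ind f0 t ts.
  have /(congr1 (mcoeff t)) := f0 (supp_sum _ _ Ls).
  rewrite mcoeff0 raddf_sum (bigD1_seq t) //= mcoeffZ mcoeffX eqxx mulr1.
  rewrite big1 ?addr0 // => t' /negPf tt'.
  by rewrite mcoeffZ mcoeffX tt' mulr0.
split=> // [m m' Lm Lm' emm'|x].
  apply/eqP; apply: contraT => mm'; have := oner_neq0 'F_2.
  rewrite -(indX [:: m; m'] (fun=> 1) _ _ _ m) ?eqxx ?mem_head //=.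
  - by rewrite inE mm'.
  - by rewrite andbT; apply/andP.
  rewrite !big_cons big_nil addr0 emm' -scalerDl.
  have -> : 1 + 1 = 0 :> 'F_2 by apply/val_inj.
  by rewrite scale0r.
have [g Lg If] := span (repr x).
exists (msupp g), (fun m => g@_m); split; first exact: supp_all.
by rewrite -nbc_pi_sum -mpolyE -[LHS]nbc_reprK; apply/nbc_piE/nbc_idealP.
Qed.

End Basis.

(** * Even sets, circuits and cuts of G, H and G' *)

Section SeriesVertex.
Variables (q : nat) (G : ograph q.+1) (w : vertex G) (k0 : 'I_q).
Local Notation wd := (widen_ord (leqnSn q)).
Local Notation ek := (wd k0).
Local Notation em := (@ord_max q).
Local Notation H := (delete_last G).
Local Notation G' := (contract_last G).
Local Notation T := (tree_edges G).
Hypothesis stdG : standard G.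
(** Edges are numbered from 0, so e_k is [k0], the largest edge outside the tree. *)
Hypothesis corankG : corank G = k0.+1.
(** The degree condition enters through this cut: e_k and e_q leave w, and no other edge does. *)
Hypothesis cross_w : forall f, cross [set w] f = (f == ek) (+) (f == em).
Implicit Types (S C : {set 'I_q}) (i j : 'I_q).

Lemma wd_inj : injective wd.
Proof. by move=> i j /(congr1 val) /= ij; apply: val_inj. Qed.

Lemma wd_neq_max i : (wd i == em) = false.
Proof. by rewrite -val_eqE /= ltn_eqF. Qed.

Lemma ord_widenP (P : 'I_q.+1 -> Prop) :
  (forall i, P (wd i)) -> P em -> forall f, P f.
Proof.
move=> hw hm f; case: (ltnP f q) => fq.
  by have -> : f = wd (Ordinal fq) by apply/val_inj.
have -> // : f = em; apply/val_inj/eqP; rewrite /= eqn_leq fq andbT.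
exact: (leq_ord f).
Qed.

Lemma cross_w_wd i : cross [set w] (wd i) = (i == k0).
Proof. by rewrite cross_w wd_neq_max addbF (inj_eq wd_inj). Qed.

Lemma cross_w_max : cross [set w] em.
Proof. by rewrite cross_w eqxx eq_sym wd_neq_max. Qed.

Lemma mem_tree (f : 'I_q.+1) : (f \in T) = (k0 < f)%N.
Proof. by rewrite inE corankG. Qed.

Lemma max_tree : em \in T.
Proof. by rewrite mem_tree /=. Qed.

(* An even set of G contains e_k iff it contains e_q, so lift_set is a bijection *)
(* between the even sets of the contraction and those of G.                    *)
Definition lift_set S : {set 'I_q.+1} :=
  [set wd i | i in S] :|: (if k0 \in S then [set em] else set0).

Definition lower_set (S : {set 'I_q.+1}) : {set 'I_q} := [set i | wd i \in S].

Lemma lift_wd S i : (wd i \in lift_set S) = (i \in S).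
Proof.
rewrite inE mem_imset; last exact: wd_inj.
by case: ifP; rewrite ?inE ?wd_neq_max orbF.
Qed.

Lemma lift_max S : (em \in lift_set S) = (k0 \in S).
Proof.
rewrite inE; case: imsetP => [[i _ /esym/eqP]|_]; first by rewrite wd_neq_max.
by case: ifP; rewrite !inE ?eqxx.
Qed.

Lemma lift_subset S S' : (lift_set S \subset lift_set S') = (S \subset S').
Proof.
apply/subsetP/subsetP => [h i|h f].
  by rewrite -2!lift_wd; apply: h.
by elim/ord_widenP: f => [i|]; rewrite ?lift_wd ?lift_max; apply: h.
Qed.

Lemma lift_inj : injective lift_set.
Proof.
move=> S S' e; apply/eqP.
by rewrite eqEsubset -!lift_subset e subxx.
Qed.

Lemma lift_set0 : lift_set set0 = set0.
Proof. by apply/setP; elim/ord_widenP => [i|]; rewrite ?lift_wd ?lift_max !inE. Qed.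

Lemma lift_lower (S : {set 'I_q.+1}) :
  (ek \in S) = (em \in S) -> lift_set (lower_set S) = S.
Proof.
move=> ekm; apply/setP; elim/ord_widenP => [i|].
  by rewrite lift_wd inE.
by rewrite lift_max inE.
Qed.

Lemma cut_parity_wd (S : {set 'I_q.+1}) (X : {set vertex G}) :
  cut_parity S X =
  \big[addb/false]_i ((wd i \in S) && cross X (wd i)) (+)
  ((em \in S) && cross X em).
Proof. by rewrite /cut_parity big_ord_recr. Qed.

Lemma evenset_series (S : {set 'I_q.+1}) :
  evenset G S -> (ek \in S) = (em \in S).
Proof.
move=> /(_ w); rewrite cut_parity_wd cross_w_max andbT.
under eq_bigr do rewrite cross_w_wd eq_sym.
rewrite (big_addb_pred1 (fun i => wd i \in S)).
by case: (ek \in S); case: (em \in S).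
Qed.

Lemma evenset_delete S : evenset H S <-> evenset G [set wd i | i in S].
Proof.
have e x : cut_parity (G := H) S [set x] =
           cut_parity (G := G) [set wd i | i in S] [set x].
  rewrite cut_parity_wd; case: imsetP => [[i _ /esym/eqP]|_] /=.
    by rewrite wd_neq_max.
  by rewrite addbF; apply: eq_bigr => i _; rewrite mem_imset //; apply: wd_inj.
by split=> h x; have := h x; rewrite e.
Qed.

Definition pull (X' : {set vertex G'}) : {set vertex G} :=
  [set x | contract_map x \in X'].

Lemma cross_pull X' i : cross (G := G') X' i = cross (pull X') (wd i).
Proof. by rewrite /cross !inE. Qed.

Lemma contract_map_ends :
  contract_map (ends G em).1 = contract_map (ends G em).2.
Proof. by apply/val_inj; rewrite /= eqxx; case: ifP. Qed.

Lemma cross_pull_max X' : cross (pull X') em = false.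
Proof. by rewrite /cross !inE contract_map_ends addbb. Qed.

Lemma pull_exists (X : {set vertex G}) :
  cross X em = false -> exists X', pull X' = X.
Proof.
rewrite /cross => uv; exists [set x' | val x' \in X].
apply/setP => x; rewrite !inE /=; case: (eqVneq x (ends G em).2) => [->|//].
by case: (_ \in X) uv; case: (_ \in X).
Qed.

Lemma contract_map_surj (x' : vertex G') : exists x, contract_map x = x'.
Proof.
exists (val x'); apply/val_inj => /=; case: eqP => [xv|//].
by have := valP x'; rewrite /= xv eqxx orbF => /eqP.
Qed.

Lemma cut_parity_pull S X' :
  cut_parity (G := G') S X' = cut_parity (lift_set S) (pull X').
Proof.
rewrite cut_parity_wd cross_pull_max andbF addbF.
by apply: eq_bigr => i _; rewrite cross_pull lift_wd.
Qed.

(** Toggling w changes the crossing of e_k and e_q only. So one of them can be given a prescribed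
    crossing, which moves cuts between G, H and G'. *)
Lemma adjust_w (b : bool) (f : 'I_q.+1) (X : {set vertex G}) :
  cross [set w] f -> exists Y : {set vertex G},
  [/\ cross Y f = b & Y = X \/ Y = symd X [set w]].
Proof.
move=> cf; case: (eqVneq (cross X f) b) => [e|ne].
  by exists X; split=> //; left.
exists (symd X [set w]); split; last by right.
by rewrite cross_symd cf; case: (cross X f) b ne => [] [].
Qed.

Lemma adjust_cross (X Y : {set vertex G}) i :
  Y = X \/ Y = symd X [set w] -> i != k0 -> cross Y (wd i) = cross X (wd i).
Proof.
by move=> [->//|->] ik; rewrite cross_symd cross_w_wd (negPf ik) addbF.
Qed.

(** A single end of e_q is no pullback from G'; toggling w repairs this, at no cost because the
    lifted set has even degree at w. *)
Lemma evenset_contract S : evenset G' S <-> evenset G (lift_set S).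
Proof.
split=> evS x; last by rewrite cut_parity_pull; apply: evenset_cut.
have pw : cut_parity (lift_set S) [set w] = false.
  rewrite cut_parity_wd cross_w_max andbT lift_max.
  under eq_bigr do rewrite cross_w_wd eq_sym.
  by rewrite (big_addb_pred1 (fun i => wd i \in lift_set S)) lift_wd addbb.
have [Y [cY hY]] := adjust_w false [set x] cross_w_max.
have -> : cut_parity (lift_set S) [set x] = cut_parity (lift_set S) Y.
  by case: hY => -> //; rewrite cut_parity_symdr pw addbF.
have [X' <-] := pull_exists cY.
by rewrite -cut_parity_pull; apply: evenset_cut.
Qed.

Lemma evenset_delete_contract S : evenset H S <-> evenset G' S /\ k0 \notin S.
Proof.
have e : k0 \notin S -> lift_set S = [set wd i | i in S].
  by move=> kS; rewrite /lift_set (negPf kS) setU0.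
split=> [/evenset_delete evS|[/evenset_contract evS kS]]; last first.
  by apply/evenset_delete; rewrite -e.
have kS : k0 \notin S.
  have := evenset_series evS; rewrite mem_imset; last exact: wd_inj.
  move=> ->; apply/imsetP => -[i _ /esym/eqP]; by rewrite wd_neq_max.
by split=> //; apply/evenset_contract; rewrite e.
Qed.

Lemma circuit_contract C : circuit G' C = circuit G (lift_set C).
Proof.
have nz S : (lift_set S == set0) = (S == set0).
  by rewrite -lift_set0 (inj_eq lift_inj).
apply/idP/idP => /circuitP[C0 evC minC]; apply/circuitP; split.
- by rewrite nz.
- exact/evenset_contract.
- move=> S sSC S0 evS; have defS := lift_lower (evenset_series evS).
  rewrite -defS in sSC S0 evS *; congr lift_set.
  by apply: minC; rewrite -?lift_subset -?nz //; apply/evenset_contract.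
- by rewrite -nz.
- exact/evenset_contract.
- move=> S sSC S0 evS; apply: lift_inj; apply: minC; rewrite ?lift_subset ?nz //.
  exact/evenset_contract.
Qed.

Lemma circuit_lift (C : {set 'I_q.+1}) :
  circuit G C -> exists2 C', circuit G' C' & C = lift_set C'.
Proof.
move=> cC; have defC := lift_lower (evenset_series (circuit_even cC)).
by exists (lower_set C); rewrite ?circuit_contract defC.
Qed.

Lemma circuit_delete C : circuit H C = circuit G' C && (k0 \notin C).
Proof.
apply/idP/andP => [/circuitP[C0 evC minC]|[/circuitP[C0 evC minC] kC]].
  have /evenset_delete_contract[evC' kC] := evC; split=> //.
  apply/circuitP; split=> // S sSC S0 evS; apply: minC => //.
  by apply/evenset_delete_contract; split=> //; apply: contra kC => /(subsetP sSC).
apply/circuitP; split=> //; first exact/evenset_delete_contract.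
by move=> S sSC S0 /evenset_delete_contract[evS _]; apply: minC.
Qed.

Lemma corank_delete : corank H = k0.
Proof.
by rewrite -[RHS]/(k0.+1.-1) -corankG /corank predn_sub.
Qed.

Lemma ends_max_neq : (ends G em).1 != (ends G em).2.
Proof.
by apply: contraTneq cross_w_max => uv; rewrite cross1 uv addbb.
Qed.

Lemma card_contract : #|vertex G'| = #|vertex G|.-1.
Proof.
rewrite card_sig -(cardC1 (ends G em).2); apply: eq_card => x.
rewrite !inE; case: (eqVneq x (ends G em).2) => [->|_]; rewrite ?orbT //.
by rewrite eq_sym (negPf ends_max_neq).
Qed.

Lemma corank_contract : corank G' = k0.+1.
Proof.
rewrite -corankG /corank card_contract.
by have : (0 < #|vertex G|)%N; [apply/card_gt0P; exists w|case: #|_|].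
Qed.

Lemma mem_tree_contract i : (i \in tree_edges G') = (k0 < i)%N.
Proof. by rewrite inE corank_contract. Qed.

Lemma mem_tree_delete i : (i \in tree_edges H) = (k0 <= i)%N.
Proof. by rewrite inE corank_delete. Qed.

Lemma tree_contract_neq i : i \in tree_edges G' -> i != k0.
Proof. by rewrite mem_tree_contract; apply: contraTneq => ->; rewrite ltnn. Qed.

Lemma standard_contract : standard G'.
Proof.
apply/standard_of_tree/spanning_treeP; split.
  apply/connectsP; split; first by apply/card_gt0P; exists (contract_map w).
  move=> X' unX' x' y'; have [x <-] := contract_map_surj x'.
  have [y <-] := contract_map_surj y'.
  have /connectsP[_ /(_ (pull X')) h] := tree_connects stdG.
  have := h _ x y; rewrite !inE; apply; elim/ord_widenP => [i|].
    by rewrite mem_tree -cross_pull => iT; apply: unX'; rewrite mem_tree_contract.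
  by rewrite cross_pull_max.
move=> F sFT /evenset_contract evF; apply: lift_inj; rewrite lift_set0.
apply: (tree_acyclic stdG) evF; apply/subsetP; elim/ord_widenP => [i|].
  by rewrite lift_wd mem_tree => /(subsetP sFT); rewrite mem_tree_contract.
by rewrite max_tree.
Qed.

Lemma standard_delete : standard H.
Proof.
apply/standard_of_tree/spanning_treeP; split.
  apply/connectsP; split; first by apply/card_gt0P; exists w.
  move=> X unX.
  have ek_un : cross (G := G) X ek = false.
    by apply: (unX k0); rewrite mem_tree_delete.
  have [Y [cY hY]] := adjust_w false (X : {set vertex G}) cross_w_max.
  have unY : uncrossed T Y.
    elim/ord_widenP => [i|//]; rewrite mem_tree => ki.
    rewrite (adjust_cross hY) ?neq_ltn ?ki ?orbT //.
    by apply: (unX i); rewrite mem_tree_delete ltnW.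
  case: hY => defY.
    by rewrite -defY => x y; have /connectsP[_ h] := tree_connects stdG; apply: h.
  (* In the toggled case e_k would cross Y although no edge of T does. *)
  have := connects_uncrossed ek (tree_connects stdG) unY.
  by rewrite defY cross_symd ek_un cross_w_wd eqxx.
move=> F sFT /evenset_delete_contract[evF kF].
apply: (tree_acyclic standard_contract) evF; apply/subsetP => i iF.
rewrite mem_tree_contract ltn_neqAle -mem_tree_delete (subsetP sFT) // andbT.
by apply: contraNneq kF => /val_inj ->.
Qed.

Lemma fund_cut_contract i j : j \in tree_edges G' ->
  (i \in fund_cut G' j) = (wd i \in fund_cut G (wd j)).
Proof.
move=> jT; apply/idP/idP => /fund_cut_exists[X unX cX]; apply/fund_cut_exists.
  exists (pull X); last by rewrite -cross_pull.
  elim/ord_widenP => [i'|_]; last exact: cross_pull_max.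
  rewrite in_setD1 (inj_eq wd_inj) mem_tree -cross_pull => h; apply: unX.
  by rewrite in_setD1 mem_tree_contract.
have /pull_exists[X' XE] : cross X em = false.
  by apply: unX; rewrite in_setD1 max_tree eq_sym wd_neq_max.
exists X'; last by rewrite cross_pull XE.
move=> i'; rewrite in_setD1 mem_tree_contract cross_pull XE => h; apply: unX.
by rewrite in_setD1 (inj_eq wd_inj) mem_tree.
Qed.

Lemma fund_cut_contract_max j : j \in tree_edges G' ->
  em \notin fund_cut G (wd j).
Proof.
move=> jT; rewrite (fund_cut_tree stdG) ?max_tree 1?eq_sym ?wd_neq_max //.
by rewrite mem_tree /= -mem_tree_contract.
Qed.

Lemma fund_cut_max : fund_cut G em = [set ek; em].
Proof.
rewrite (@fund_cut_cross _ _ stdG em [set w]) ?cross_w_max //.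
  by apply/setP; elim/ord_widenP => [i|];
    rewrite !inE ?cross_w_wd ?cross_w_max ?(inj_eq wd_inj) ?wd_neq_max ?orbF ?eqxx ?orbT.
elim/ord_widenP => [i|]; last by rewrite !inE eqxx.
rewrite in_setD1 mem_tree cross_w_wd => /andP[_ ki]; by rewrite -val_eqE gtn_eqF.
Qed.

Lemma fund_cut_delete_bridge : fund_cut H k0 = [set k0].
Proof.
rewrite (@fund_cut_cross _ _ standard_delete k0 [set w]) //.
- by apply/setP => i; rewrite !inE -cross_w_wd.
- move=> i; rewrite in_setD1 => /andP[ik _]; rewrite -[LHS]/(cross [set w] (wd i)).
  by rewrite cross_w_wd (negPf ik).
- by rewrite -[cross _ _]/(cross [set w] ek) cross_w_wd eqxx.
Qed.

(** The vertex sets defining the two cuts differ at most in w. Toward G' the set must not be crossed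
    by e_q; toward H it must not be crossed by e_k, a tree edge there. *)
Lemma fund_cut_delete i j : j \in tree_edges G' ->
  (i \in fund_cut H j) = (i != k0) && (i \in fund_cut G' j).
Proof.
move=> jT; have jk := tree_contract_neq jT.
have sub i' : i' \in tree_edges G' -> i' \in tree_edges H.
  by rewrite mem_tree_contract mem_tree_delete; apply: ltnW.
apply/idP/andP => [/fund_cut_exists[X unX cX]|[ik /fund_cut_exists[X' unX' cX']]].
  have ik : i != k0.
    apply: contraTneq cX => ->; rewrite unX // in_setD1 eq_sym jk /=.
    by rewrite mem_tree_delete.
  split=> //; apply/fund_cut_exists.
  have [Y [/pull_exists[Y' YE] hY]] := adjust_w false (X : {set vertex G}) cross_w_max.
  exists Y'; last by rewrite cross_pull YE (adjust_cross hY).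
  move=> i'; rewrite in_setD1 => /andP[i'j i'T].
  rewrite cross_pull YE (adjust_cross hY) ?tree_contract_neq //.
  by apply: (unX i'); rewrite in_setD1 i'j sub.
apply/fund_cut_exists.
have ck : cross [set w] ek by rewrite cross_w_wd.
have [Y [cY hY]] := adjust_w false (pull X') ck.
exists Y; last by rewrite -[cross _ _]/(cross Y (wd i)) (adjust_cross hY) // -cross_pull.
move=> i'; rewrite in_setD1 -[cross _ _]/(cross Y (wd i')) => /andP[i'j i'T].
case: (eqVneq i' k0) => [->//|i'k].
rewrite (adjust_cross hY) // -cross_pull; apply: unX'; rewrite in_setD1 i'j.
by rewrite mem_tree_contract ltn_neqAle eq_sym val_eqE i'k -mem_tree_delete.
Qed.


(** * The substitution x_q = x_k *)

Definition proj (f : 'I_q.+1) : 'I_q := odflt k0 (insub (f : nat)).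

Lemma proj_wd i : proj (wd i) = i.
Proof. by rewrite /proj -[nat_of_ord _]/(val i) valK. Qed.

(** The default [k0] in [proj] is what sends x_q to x_k. *)
Lemma proj_max : proj em = k0.
Proof. by rewrite /proj insubN //= ltnn. Qed.

(* theta_q = x_k + x_q identifies x_q with x_k. *)
Local Notation psi :=
  (comp_mpoly [tuple ('X_(proj f) : {mpoly 'F_2[q]}) | f < q.+1]).
Local Notation xk := ('X_k0 : {mpoly 'F_2[q]}).

Lemma psiX f : psi 'X_f = 'X_(proj f).
Proof. by rewrite comp_mpolyXU -tnth_nth tnth_mktuple. Qed.

Lemma mwidenXU i : mwiden ('X_i : {mpoly 'F_2[q]}) = 'X_(wd i).
Proof. by rewrite mwidenX mnmwiden1. Qed.

Lemma psi_mwiden (f : {mpoly 'F_2[q]}) : psi (mwiden f) = f.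
Proof.
have id0 : is_ideal (fun g : {mpoly 'F_2[q]} => g = 0).
  by split=> // [g h -> ->|a g ->]; rewrite ?addr0 ?mulr0.
apply/eqP; rewrite eq_sym -subr_eq0; apply/eqP.
apply: (rmorph_sub_ideal (sg := psi \o @mwiden q 'F_2) id0) => [c|i] /=.
  by rewrite mwidenC comp_mpolyC.
by rewrite mwidenXU psiX proj_wd subrr.
Qed.

Lemma broken_lift_wd C i : (wd i \in broken (lift_set C)) = (i \in broken C).
Proof.
rewrite !in_broken lift_wd; congr (_ && ~~ _).
apply/forall_inP/forall_inP => h f; first by rewrite -lift_wd => /h.
by elim/ord_widenP: f => [f|_]; [rewrite lift_wd => /h|exact: ltnW (ltn_ord i)].
Qed.

(** A lift containing e_q also contains the smaller e_k, so e_q is never its minimum. *)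
Lemma broken_lift_max C : (em \in broken (lift_set C)) = (k0 \in C).
Proof.
rewrite in_broken lift_max; case: (boolP (k0 \in C)) => //= kC.
apply/forall_inPn; exists ek; first by rewrite lift_wd.
by rewrite -ltnNge /=.
Qed.

Lemma xprod_lift C : xprod (broken (lift_set C)) =
  mwiden (xprod (broken C)) * (if k0 \in C then 'X_em else 1).
Proof.
rewrite /xprod rmorph_prod big_mkcond big_ord_recr /= broken_lift_max.
congr (_ * _); rewrite [RHS]big_mkcond; apply: eq_bigr => i _.
by rewrite broken_lift_wd mwidenXU.
Qed.

Lemma psi_xprod_lift C : psi (xprod (broken (lift_set C))) =
  xprod (broken C) * (if k0 \in C then xk else 1).
Proof.
rewrite xprod_lift rmorphM /= psi_mwiden; congr (_ * _).
by case: ifP => _; rewrite ?psiX ?proj_max ?comp_mpoly1.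
Qed.

Lemma theta_lift j : j \in tree_edges G' ->
  theta G (wd j) = mwiden (theta G' j).
Proof.
move=> jT; rewrite /theta rmorph_sum big_mkcond big_ord_recr /=.
rewrite (negPf (fund_cut_contract_max jT)) addr0 [RHS]big_mkcond.
by apply: eq_bigr => i _; rewrite -fund_cut_contract // mwidenXU.
Qed.

Lemma theta_max : theta G em = 'X_ek + 'X_em.
Proof.
rewrite /theta fund_cut_max big_setU1 ?big_set1 //.
by rewrite inE wd_neq_max.
Qed.

Lemma theta_bridge : theta H k0 = xk.
Proof. by rewrite /theta fund_cut_delete_bridge big_set1. Qed.

Lemma theta_delete j : j \in tree_edges G' ->
  theta G' j = theta H j + (k0 \in fund_cut G' j)%:R * xk.
Proof.
move=> jT; rewrite /theta [LHS]big_mkcond [in RHS]big_mkcond /=.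
rewrite (bigD1 k0) //= [in RHS](bigD1 k0) //= fund_cut_delete // eqxx add0r addrC.
congr (_ + _); last by case: ifP; rewrite ?mul1r ?mul0r.
by apply: eq_bigr => i ik; rewrite fund_cut_delete // ik.
Qed.

(** * The ideals A, J(H), J(G') and J(G) *)

Definition series_gen (g : {mpoly 'F_2[q]}) : Prop :=
  broken_gen H g \/ g \in [seq theta G' j | j <- enum (tree_edges G')].

Local Notation A := (igen series_gen).

Lemma series_gen_theta j : j \in tree_edges G' -> A (theta G' j).
Proof. by move=> jT; apply: igen_mem; right; apply: map_f; rewrite mem_enum. Qed.

Lemma series_gen_broken C : circuit G' C -> k0 \notin C -> A (xprod (broken C)).
Proof.
by move=> cC kC; apply: igen_mem; left; exists C => //; rewrite circuit_delete cC.
Qed.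

Lemma series_min (K : {mpoly 'F_2[q]} -> Prop) f : is_ideal K ->
  (forall C, circuit G' C -> k0 \notin C -> K (xprod (broken C))) ->
  (forall j, j \in tree_edges G' -> K (theta G' j)) -> A f -> K f.
Proof.
move=> idK hC hj; apply: igen_min => // g [[C cC ->]|/mapP[j jT ->]].
  by move: cC; rewrite circuit_delete => /andP[]; apply: hC.
by apply: hj; rewrite -mem_enum.
Qed.

Lemma series_sub_contract f : A f -> in_nbc_ideal G' f.
Proof.
apply: series_min => [|C cC _|j jT]; first exact: in_nbc_ideal_is_ideal.
  exact: nbc_circuit.
exact: nbc_theta.
Qed.

(** In H the form of the bridge e_k is x_k, and every other form differs from that of G' by a
    multiple of x_k. *)
Lemma nbc_ideal_deleteE f : in_nbc_ideal H f <-> addid A xk f.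
Proof.
have idH := @in_nbc_ideal_is_ideal _ H.
have idA : is_ideal (addid A xk) by apply/addid_ideal/igen_ideal.
have subA g : A g -> addid A xk g by exists 0; rewrite mul0r subr0.
have Axk : addid A xk xk by exists 1; rewrite mul1r subrr; apply: igen_0.
have Hxk : in_nbc_ideal H xk.
  by rewrite -theta_bridge; apply: nbc_theta; rewrite mem_tree_delete.
split=> [|[a Aa]].
  apply: nbc_min => // [C|j jT].
    by rewrite circuit_delete => /andP[cC kC]; apply/subA/series_gen_broken.
  case: (eqVneq j k0) => [->|jk]; first by rewrite theta_bridge.
  have jT' : j \in tree_edges G'.
    by rewrite mem_tree_contract ltn_neqAle eq_sym val_eqE jk -mem_tree_delete.
  have -> : theta H j = theta G' j - (k0 \in fund_cut G' j)%:R * xk.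
    by rewrite theta_delete // addrK.
  by apply: idealB => //; [apply/subA/series_gen_theta|apply: idealM].
rewrite -[f](subrK (a * xk)); apply: idealD => //; last exact: idealM.
apply: series_min Aa => // [C cC kC|j jT].
  by apply: nbc_circuit; rewrite circuit_delete cC.
rewrite theta_delete //; apply: idealD => //; last exact: idealM.
by apply: nbc_theta; rewrite mem_tree_delete ltnW // -mem_tree_contract.
Qed.

Lemma series_nzdiv f : A (xk * f) -> A f.
Proof.
(* x_k comes last, as [regular_last] requires, and joins the family as the cut form of the bridge
   e_k of H. *)
pose r := rcons (enum (tree_edges G')) k0.
pose F j := if j == k0 then delta_mx 0 k0 else indrow (fund_cut G' j).
apply: regular_last.
have -> : rcons [seq theta G' j | j <- enum (tree_edges G')] xk =
          [seq linform v | v <- map F r].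
  rewrite -map_comp map_rcons /= {2}/F eqxx linform_delta; congr rcons.
  apply/eq_in_map => j; rewrite mem_enum => jT /=.
  by rewrite /F (negPf (tree_contract_neq jT)) linform_indrow.
have rT : r =i tree_edges H.
  move=> i; rewrite mem_rcons inE mem_enum mem_tree_contract mem_tree_delete.
  by rewrite [RHS]leq_eqVlt eq_sym val_eqE.
apply: nbc_regular; last by case/andP: standard_delete.
move=> B cB; have : free ([seq delta_mx 0 b | b <- enum (~: B)] ++ map F r).
  apply: (@cut_forms_free _ H standard_delete B k0 r F
            (fun j => (k0 \in fund_cut G' j)%:R)) => //.
  - rewrite rcons_uniq enum_uniq andbT mem_enum.
    by apply/negP => /tree_contract_neq; rewrite eqxx.
  - by rewrite mem_tree_delete.
  - exact: fund_cut_delete_bridge.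
  - by rewrite /F eqxx.
  move=> j jT jk; rewrite /F (negPf jk); apply/rowP => i; rewrite !mxE.
  have jT' : j \in tree_edges G'.
    by rewrite mem_tree_contract ltn_neqAle eq_sym val_eqE jk -mem_tree_delete.
  rewrite fund_cut_delete //; case: (eqVneq i k0) => [->|_] /=.
    by rewrite add0r mulr1.
  by rewrite mulr0 addr0.
move/linid_regular; apply: regular_ext => g; rewrite linid_deltaE.
by apply: monid_ext => m; split=> -[b bB mb]; exists b; rewrite // mem_enum in bB *.
Qed.

(** A + x_k J(G'), which will turn out to be J(G) with x_q eliminated. *)
Definition series_ideal (f : {mpoly 'F_2[q]}) : Prop :=
  exists a b, [/\ A a, in_nbc_ideal G' b & f = a + xk * b].

Lemma series_ideal_is_ideal : is_ideal series_ideal.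
Proof.
have idA : is_ideal A by exact: igen_ideal.
have idG' := @in_nbc_ideal_is_ideal _ G'.
split.
- by exists 0, 0; split; [exact: ideal0|exact: ideal0|rewrite mulr0 addr0].
- move=> f g [a [b [Aa Jb ->]]] [a' [b' [Aa' Jb' ->]]].
  by exists (a + a'), (b + b'); split; [exact: idealD|exact: idealD|ring].
- move=> c f [a [b [Aa Jb ->]]].
  by exists (c * a), (c * b); split; [exact: idealM|exact: idealM|ring].
Qed.

Lemma psi_nbc_ideal f : in_nbc_ideal G f -> series_ideal (psi f).
Proof.
have idJ := series_ideal_is_ideal; move: f.
have idK : is_ideal (fun f => series_ideal (psi f)).
  split=> [|f g|a f]; rewrite ?rmorph0 ?rmorphD ?rmorphM; first exact: ideal0.
    exact: idealD.
  exact: idealM.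
move=> f; apply: (nbc_min idK) => [C /circuit_lift[C' cC' ->]|].
  rewrite psi_xprod_lift; case: ifP => kC.
    exists 0, (xprod (broken C')); rewrite add0r mulrC.
    by split=> //; [exact: igen_0|exact: nbc_circuit].
  exists (xprod (broken C')), 0; rewrite mulr1 mulr0 addr0; split=> //.
    by apply: series_gen_broken => //; rewrite kC.
  by apply: ideal0; exact: in_nbc_ideal_is_ideal.
elim/ord_widenP => [j|_]; last first.
  rewrite theta_max rmorphD /= !psiX proj_wd proj_max mpolyF2_addrr.
  exact: ideal0.
rewrite mem_tree -[(k0 < _)%N]/(k0 < j)%N -mem_tree_contract => jT.
rewrite theta_lift // psi_mwiden; exists (theta G' j), 0.
rewrite mulr0 addr0; split=> //; first exact: series_gen_theta.
by apply: ideal0; exact: in_nbc_ideal_is_ideal.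
Qed.

Lemma mwiden_series_ideal f : series_ideal f -> in_nbc_ideal G (mwiden f).
Proof.
have idG := @in_nbc_ideal_is_ideal _ G.
(* The multiplier K treats the summands a and x_k b alike, with K = 1 and K = x_k. *)
have mwI (K : {mpoly 'F_2[q.+1]}) :
    is_ideal (fun f : {mpoly 'F_2[q]} => in_nbc_ideal G (K * mwiden f)).
  split=> [|g h|a g]; rewrite ?rmorph0 ?rmorphD ?rmorphM ?mulr0 ?mulrDr.
  - exact: ideal0.
  - exact: idealD.
  - by rewrite mulrCA; exact: idealM.
have thG j : j \in tree_edges G' -> in_nbc_ideal G (mwiden (theta G' j)).
  move=> jT; rewrite -theta_lift //; apply: nbc_theta.
  by rewrite mem_tree /= -mem_tree_contract.
have ciG C : circuit G' C -> k0 \notin C ->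
    in_nbc_ideal G (mwiden (xprod (broken C))).
  move=> cC kC; have := nbc_circuit (G := G) (C := lift_set C).
  by rewrite xprod_lift (negPf kC) mulr1 -circuit_contract; apply.
case=> a [b [Aa Jb ->]]; rewrite mwidenD mwidenM; apply: idealD => //.
  rewrite -[mwiden a]mul1r; apply: (series_min (mwI 1)) Aa => [C cC kC|j jT].
    by rewrite mul1r; apply: ciG.
  by rewrite mul1r; apply: thG.
apply: (nbc_min (mwI (mwiden xk))) Jb => [C cC|j jT]; last by apply: idealM => //; apply: thG.
case: (boolP (k0 \in C)) => kC; last by apply: idealM => //; apply: ciG.
rewrite /= mwidenXU; set g := mwiden _.
(* Modulo theta_q, x_k is traded for x_q up to sign, and g x_q is the broken circuit monomial of the
   lifted circuit. *)
have -> : 'X_ek * g = g * theta G em - g * 'X_em by rewrite theta_max; ring.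
apply: idealB => //; first by apply: idealM => //; apply/nbc_theta/max_tree.
have := nbc_circuit (G := G) (C := lift_set C).
by rewrite xprod_lift kC -circuit_contract; apply.
Qed.

Lemma nbc_mwiden_psi f : in_nbc_ideal G (f - mwiden (psi f)).
Proof.
have idG := @in_nbc_ideal_is_ideal _ G.
apply: (rmorph_sub_ideal (sg := @mwiden q 'F_2 \o psi) idG) => [c|] /=.
  by rewrite comp_mpolyC mwidenC.
elim/ord_widenP => [i|]; rewrite psiX mwidenXU.
  by rewrite proj_wd subrr; apply: ideal0.
rewrite proj_max; have -> : 'X_em - 'X_ek = theta G em - ('X_ek + 'X_ek).
  by rewrite theta_max; ring.
by rewrite mpolyF2_addrr subr0; apply/nbc_theta/max_tree.
Qed.

(** * The sets L(G), L(H) and L(G') *)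

Lemma fundamental_lift i C : circuit G' C ->
  fundamental G (wd i) (lift_set C) = fundamental G' i C.
Proof.
move=> cC; rewrite /fundamental corankG corank_contract -circuit_contract cC.
congr (_ && _); apply/subsetP/subsetP => h f.
  rewrite -lift_wd => /h; rewrite !in_setU1 (inj_eq wd_inj) mem_tree.
  by rewrite mem_tree_contract.
elim/ord_widenP: f => [f|_]; last by rewrite in_setU1 max_tree orbT.
rewrite lift_wd => /h; rewrite !in_setU1 (inj_eq wd_inj) mem_tree.
by rewrite mem_tree_contract.
Qed.

Lemma fundamental_max (C : {set 'I_q.+1}) : ~~ fundamental G em C.
Proof. by rewrite /fundamental corankG ltnNge /= ltn_ord. Qed.

(** The tree of H has e_k in addition to that of G', but C avoids e_k; and i = k would put C inside
    the tree of G'. *)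
Lemma fundamental_delete i C : circuit H C ->
  fundamental H i C = fundamental G' i C.
Proof.
rewrite circuit_delete => /andP[cC kC].
rewrite /fundamental corank_delete corank_contract circuit_delete cC kC /=.
apply/andP/andP => -[ik /subsetP sC].
  split; first exact: ltnW.
  apply/subsetP => f fC; have := sC f fC; rewrite !in_setU1 => /orP[->//|fT].
  rewrite mem_tree_contract ltn_neqAle -mem_tree_delete fT andbT.
  by rewrite (contraNneq _ kC) ?orbT // => /val_inj ->.
have ink : i != k0.
  apply: contraNneq (circuit_not_tree standard_contract cC) => ik0.
  apply/subsetP => f fC; have := sC f fC; rewrite in_setU1 ik0.
  by case: eqP => [fk|//]; rewrite -fk fC in kC.
split; first by rewrite ltn_neqAle val_eqE ink.
apply/subsetP => f /sC; rewrite !in_setU1 => /orP[->//|].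
by rewrite mem_tree_contract mem_tree_delete => /ltnW ->; rewrite orbT.
Qed.

Lemma dmin_lift j : dmin G (wd j) = wd (dmin G' j).
Proof.
case: (boolP (j \in tree_edges G')) => jT; last first.
  rewrite !dmin_small // mem_tree /=; by rewrite mem_tree_contract in jT.
have [dD mind] := dminP standard_contract jT.
apply: dmin_eq => //; first by rewrite mem_tree /= -mem_tree_contract.
  by rewrite -fund_cut_contract.
elim/ord_widenP => [i|]; first by rewrite -fund_cut_contract //; apply: mind.
by rewrite (negPf (fund_cut_contract_max jT)).
Qed.

Lemma dmin_max : dmin G em = ek.
Proof.
apply: (dmin_eq stdG max_tree); rewrite fund_cut_max ?set21 // => i.
by rewrite !inE => /orP[]/eqP-> //=; apply: ltnW.
Qed.

Lemma card_broken_lift C : #|broken (lift_set C)| = (#|broken C| + (k0 \in C))%N.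
Proof.
rewrite -!sum1_card big_mkcond big_ord_recr /= broken_lift_max; congr (_ + _)%N.
by rewrite [RHS]big_mkcond; apply: eq_bigr => i _; rewrite broken_lift_wd.
Qed.

(** When C passes through e_k, its lift has e_q as an additional broken edge. In the non-fundamental
    case e_q contributes x_k since d_q = k; in the fundamental case C is C_k, whose power of x_k
    grows by one. *)
Lemma mbar_lift C : circuit G' C -> mbar G (lift_set C) =
  (mnmwiden (mbar G' C) + U_(ek) *+ (k0 \in C))%MM.
Proof.
move=> cC; case: (pickP (fun i => fundamental G' i C)) => [i fC|nf].
  have fC' : fundamental G (wd i) (lift_set C) by rewrite fundamental_lift.
  rewrite (mbar_fund stdG fC') (mbar_fund standard_contract fC) card_broken_lift.
  have -> : mnmwiden (U_(i) *+ #|broken C|)%MM = (U_(wd i) *+ #|broken C|)%MM.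
    elim: #|_| => [|n IH]; first by rewrite !mulm0n mnmwiden0.
    by rewrite !mulmS mnmwidenD IH mnmwiden1.
  case: (boolP (k0 \in C)) => kC; last by rewrite addn0 mulm0n addm0.
  suff -> : i = k0 by rewrite addn1 mulmS mulm1n addmC.
  case/and3P: fC => _ _ /subsetP/(_ _ kC); rewrite in_setU1.
  by rewrite mem_tree_contract ltnn orbF => /eqP.
rewrite !mbar_nonfund => [|i|]; first 1 last.
- by rewrite nf.
- by elim/ord_widenP => [i|]; rewrite ?fundamental_max ?fundamental_lift ?nf.
rewrite big_mkcond big_ord_recr /= broken_lift_max dmin_max; congr (_ + _)%MM.
  rewrite mnmwiden_sum [RHS]big_mkcond; apply: eq_bigr => j _.
  by rewrite broken_lift_wd dmin_lift mnmwiden1.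
by case: (k0 \in C); rewrite ?mulm1n ?mulm0n.
Qed.

(** For a tree edge e_j of G', C meets its cut in a second edge, which is neither e_k nor a tree
    edge and hence precedes e_k. So the minimum of the cut lies below e_k and survives the removal
    of e_k. *)
Lemma dmin_delete C j : circuit H C -> j \in C ->
  dmin H j = dmin G' j /\ (dmin G' j < k0)%N.
Proof.
rewrite circuit_delete => /andP[cC kC] jC.
have jk : j != k0 by apply: contraNneq kC => <-.
case: (boolP (j \in tree_edges G')) => jT; last first.
  have jk0 : (j < k0)%N.
    by rewrite ltn_neqAle val_eqE jk leqNgt -mem_tree_contract.
  by rewrite !dmin_small // mem_tree_delete -ltnNge.
have [X [unX cX DX]] := fund_cut_coboundary standard_contract jT.
have [i ij /andP[iC ci]] := evenset_cut_other (circuit_even cC) jC cX.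
have iD : i \in fund_cut G' j by rewrite DX inE.
have ik : (i < k0)%N.
  rewrite ltn_neqAle val_eqE; apply/andP; split.
    by apply: contraNneq kC => <-.
  rewrite leqNgt -mem_tree_contract; apply/negP => iT.
  by move: iD; rewrite (fund_cut_tree standard_contract) // (negPf ij).
have [dD mind] := dminP standard_contract jT.
have dk : (dmin G' j < k0)%N by apply: leq_ltn_trans ik; apply: mind.
split=> //; apply: (dmin_eq standard_delete).
- by rewrite mem_tree_delete ltnW // -mem_tree_contract.
- by rewrite fund_cut_delete // dD -val_eqE ltn_eqF.
- by move=> f; rewrite fund_cut_delete // => /andP[_]; apply: mind.
Qed.

Lemma mbar_delete C : circuit H C ->
  mbar H C = mbar G' C /\ mbar G' C k0 = 0%N.
Proof.
move=> cC; have sC j : j \in broken C -> j \in C := subsetP (broken_sub C) j.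
case: (pickP (fun i => fundamental G' i C)) => [i fC|nf].
  have fC' : fundamental H i C by rewrite fundamental_delete.
  rewrite (mbar_fund standard_delete fC') (mbar_fund standard_contract fC).
  split=> //; rewrite mulmnE mnmE; case/and3P: fC' => ik _ _.
  by rewrite corank_delete in ik; rewrite -val_eqE ltn_eqF.
rewrite !mbar_nonfund => [|i|i]; rewrite ?fundamental_delete ?nf //.
split; first by apply: eq_bigr => j /sC jC; have [->] := dmin_delete cC jC.
rewrite mnm_sumE big1 // => j /sC jC; have [_ dk] := dmin_delete cC jC.
by rewrite mnmE -val_eqE ltn_eqF.
Qed.

Lemma mnmwiden_lepm (m m' : 'X_{1..q}) :
  (mnmwiden m <= mnmwiden m')%MM = (m <= m')%MM.
Proof.
apply/mnm_lepP/mnm_lepP => h i; first by have := h (wd i); rewrite !mnmwiden_widen.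
by elim/ord_widenP: i => [i|]; rewrite ?mnmwiden_widen ?mnmwiden_ordmax.
Qed.

Lemma Monk_mnmwiden (m : 'X_{1..q}) : Monk G (mnmwiden m) = Monk G' m.
Proof.
apply/MonkP/MonkP => h i.
  by rewrite mem_tree_contract -mnmwiden_widen => ki; apply: h; rewrite mem_tree.
elim/ord_widenP: i => [i|_]; last by rewrite mnmwiden_ordmax.
by rewrite mem_tree mnmwiden_widen => ki; apply: h; rewrite mem_tree_contract.
Qed.

Lemma Monk_delete (m : 'X_{1..q}) : Monk H m = Monk G' m && (m k0 == 0%N).
Proof.
apply/MonkP/andP => [h|[/MonkP h /eqP mk] i].
  split; last by rewrite h // mem_tree_delete.
  apply/MonkP => i; rewrite mem_tree_contract => ki; apply: h.
  by rewrite mem_tree_delete ltnW.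
rewrite mem_tree_delete leq_eqVlt => /predU1P[/val_inj <- //|ki].
by apply: h; rewrite mem_tree_contract.
Qed.

(** A circuit through e_k has x_k in its monomial and cannot divide; the others are circuits of H
    with the same monomial. *)
Lemma Lset_delete (m : 'X_{1..q}) :
  m k0 = 0%N -> Lset G (mnmwiden m) = Lset H m.
Proof.
move=> mk; rewrite !LsetE Monk_mnmwiden Monk_delete mk andbT; congr (_ && ~~ _).
apply/existsP/existsP => -[C /andP[cC]].
  have [C' cC' ->] := circuit_lift cC; rewrite mbar_lift //.
  case: (boolP (k0 \in C')) => kC'.
    move=> /mnm_lepP/(_ ek); rewrite mnmE mulmnE mnmE eqxx !mnmwiden_widen mk.
    by rewrite addn1.
  rewrite mulm0n addm0 mnmwiden_lepm => le; exists C'.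
  have cH : circuit H C' by rewrite circuit_delete cC'.
  by rewrite cH /=; have [->] := mbar_delete cH.
have [-> _] := mbar_delete cC; move: cC; rewrite circuit_delete => /andP[cC kC] le.
exists (lift_set C); rewrite -circuit_contract cC mbar_lift // (negPf kC).
by rewrite mulm0n addm0 mnmwiden_lepm.
Qed.

(** For circuits through e_k, lifting adds a factor x_k on both sides; for the others the monomial
    is free of x_k, so the extra x_k does not affect divisibility. *)
Lemma Lset_contract (m : 'X_{1..q}) :
  Lset G (mnmwiden (m + U_(k0))%MM) = Lset G' m.
Proof.
rewrite !LsetE Monk_mnmwiden; congr (_ && ~~ _).
  apply/MonkP/MonkP => h i iT; have := h i iT; rewrite mnmE mnmE.
    by move/eqP; rewrite addn_eq0 => /andP[/eqP].
  by rewrite -val_eqE ltn_eqF ?addn0 // -mem_tree_contract.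
apply/existsP/existsP => -[C /andP[cC]].
  have [C' cC' ->] := circuit_lift cC; rewrite mbar_lift // mnmwidenD mnmwiden1.
  case: (boolP (k0 \in C')) => kC' /mnm_lepP le; exists C'; rewrite cC'.
    apply/mnm_lepP => i; have := le (wd i).
    by rewrite mulm1n !mnmE leq_add2r -!/(mnmwiden _ _) !mnmwiden_widen.
  have [_ mk] : mbar H C' = mbar G' C' /\ mbar G' C' k0 = 0%N.
    by apply: mbar_delete; rewrite circuit_delete cC'.
  apply/mnm_lepP => i; case: (eqVneq i k0) => [->|ik]; first by rewrite mk.
  have := le (wd i); rewrite mulm0n addm0 mnmwiden_widen mnmE mnmwiden_widen mnmE.
  by rewrite (inj_eq wd_inj) eq_sym (negPf ik) addn0.
move=> le; exists (lift_set C); rewrite -circuit_contract cC mbar_lift //.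
rewrite mnmwidenD mnmwiden1; apply/mnm_lepP => f; rewrite !mnmE mulmnE.
apply: leq_add; last by rewrite mnmE; case: (k0 \in C); rewrite ?muln1 ?muln0.
by move: f; apply/mnm_lepP; rewrite mnmwiden_lepm.
Qed.

Lemma mnm_lower (t : 'X_{1..q.+1}) :
  t em = 0%N -> t = mnmwiden [multinom t (wd i) | i < q].
Proof.
move=> tm; apply/mnmP; elim/ord_widenP => [i|].
  by rewrite mnmwiden_widen mnmE.
by rewrite mnmwiden_ordmax.
Qed.

Lemma Lset_series (t : 'X_{1..q.+1}) : Lset G t ->
  (exists2 m, Lset H m & t = mnmwiden m) \/
  (exists2 m, Lset G' m & t = mnmwiden (U_(k0) + m)%MM).
Proof.
move=> Lt; have /MonkP/(_ _ max_tree)/mnm_lower : Monk G t.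
  by move: Lt; rewrite LsetE => /andP[].
move: [multinom _ | i < q] => m tE; rewrite tE in Lt *.
case: (eqVneq (m k0) 0%N) => mk; first by left; exists m; rewrite -?Lset_delete.
right; have mE : m = (m - U_(k0) + U_(k0))%MM.
  rewrite submK //; apply/mnm_lepP => j; rewrite mnmE.
  by case: eqP => [<-|] //=; rewrite lt0n.
by exists (m - U_(k0))%MM; rewrite -?Lset_contract -?mE // addmC -mE.
Qed.

Lemma Lset_delete_mnmwiden (m : 'X_{1..q}) : Lset H m -> Lset G (mnmwiden m).
Proof.
move=> Lm; rewrite Lset_delete //.
by move: Lm; rewrite LsetE Monk_delete => /andP[/andP[_ /eqP]].
Qed.

(** * Independence and spanning for G *)

Lemma series_NBC_basis :
  has_NBC_basis H -> has_NBC_basis G' -> has_NBC_basis G.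
Proof.
move=> /has_NBC_basisP[indH spanH] /has_NBC_basisP[indG' spanG'].
have idG := @in_nbc_ideal_is_ideal _ G.
have idG' := @in_nbc_ideal_is_ideal _ G'.
have idA : is_ideal A by exact: igen_ideal.
have suppD n (L : pred 'X_{1..n}) (f g : {mpoly 'F_2[n]}) :
    monid L f -> monid L g -> monid L (f + g).
  move=> Lf Lg m; rewrite -mcoeff_msupp => /msuppD_le; rewrite mem_cat.
  by rewrite !mcoeff_msupp => /orP[/Lf|/Lg].
have suppZX n (L : pred 'X_{1..n}) (c : 'F_2) m : L m -> monid L (c *: 'X_[m]).
  move=> Lm m'; rewrite -mcoeff_msupp => /msuppZ_le.
  by rewrite msuppX inE => /eqP->.
have supp0 n (L : pred 'X_{1..n}) : monid L (0 : {mpoly 'F_2[n]}).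
  by move=> m; rewrite mcoeff0 eqxx.
apply/has_NBC_basisP; split=> [f Lf Jf|f].
  (* Sort the monomials of f by divisibility by x_k. *)
  have [g0 [g1 [L0 L1 fE]]] : exists g0 g1,
      [/\ monid (Lset H) g0, monid (Lset G') g1 & f = mwiden (g0 + xk * g1)].
    rewrite [f]mpolyE big_seq.
    elim/big_ind: _ => [|f1 f2 [a [b [La Lb ->]]] [a' [b' [La' Lb' ->]]]|t tf].
    - by exists 0, 0; split; rewrite ?mulr0 ?addr0 ?mwiden0.
    - exists (a + a'), (b + b'); split; try exact: suppD.
      by rewrite -mwidenD; congr mwiden; ring.
    have Lt : Lset G t by apply: (Lf t); rewrite -mcoeff_msupp.
    move: (f@_t) => c; have [[m Lm ->]|[m Lm ->]] := Lset_series Lt.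
      exists (c *: 'X_[m]), 0; split=> //; first exact: suppZX.
      by rewrite mulr0 addr0 mwidenZ mwidenX.
    exists 0, (c *: 'X_[m]); split=> //; first exact: suppZX.
    by rewrite add0r -scalerAr -mpolyXD mwidenZ mwidenX.
  have [a [b [Aa Jb]]] := psi_nbc_ideal Jf; rewrite fE psi_mwiden => e.
  (* Here g0 + x_k g1 = a + x_k b, so g0 lies in A + (x_k) = J(H). *)
  have g00 : g0 = 0.
    apply: indH => //; apply/nbc_ideal_deleteE; exists (b - g1).
    have -> : g0 - (b - g1) * xk = (g0 + xk * g1) - xk * b by ring.
    by rewrite e addrK.
  (* With g0 gone, x_k (g1 - b) lies in A; cancelling x_k puts g1 - b into A and so into J(G'). *)
  have g10 : g1 = 0.
    apply: indG' => //; rewrite -[g1](subrK b); apply: idealD => //.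
    apply/series_sub_contract/series_nzdiv.
    have -> : xk * (g1 - b) = (g0 + xk * g1) - xk * b - g0 by ring.
    by rewrite e addrK g00 subr0.
  by rewrite g00 g10 mulr0 addr0 mwiden0.
(* Reducing psi f modulo J(H) leaves a multiple h x_k modulo A; then h is reduced modulo J(G'). *)
have [g0 L0 /nbc_ideal_deleteE[h Ah]] := spanH (psi f).
have [g1 L1 Jh] := spanG' h.
exists (mwiden (g0 + xk * g1)).
  rewrite mwidenD; apply: (suppD).
    rewrite [g0]mpolyE rmorph_sum big_seq /=.
    elim/big_ind: _ => [|? ?|t tg]; [exact: supp0|exact: suppD|].
    rewrite mwidenZ mwidenX; apply/suppZX/Lset_delete_mnmwiden/L0.
    by rewrite -mcoeff_msupp.
  rewrite [g1]mpolyE mulr_sumr rmorph_sum big_seq /=.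
  elim/big_ind: _ => [|? ?|t tg]; [exact: supp0|exact: suppD|].
  rewrite -scalerAr -mpolyXD mwidenZ mwidenX; apply: suppZX.
  by rewrite addmC Lset_contract; apply: L1; rewrite -mcoeff_msupp.
have -> : f - mwiden (g0 + xk * g1) =
    (f - mwiden (psi f)) + mwiden (psi f - (g0 + xk * g1)).
  by rewrite mwidenB addrA subrK.
apply: idealD => //; first exact: nbc_mwiden_psi.
apply: mwiden_series_ideal.
exists (psi f - g0 - h * xk), (h - g1); split=> //.
by move: (psi f) => u; ring.
Qed.

End SeriesVertex.

Local Close Scope ring_scope.

(** A loop at w would use up degree two by itself, leaving nothing for the other of the two
    edges. *)
Lemma cross_degree2 q (G : ograph q.+1) (w : vertex G) (ek : 'I_q.+1) :
  ek != ord_max -> degree w = 2 ->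
  [set e : 'I_q.+1 | incident e w] = [set ek; ord_max] ->
  forall f, cross [set w] f = (f == ek) (+) (f == ord_max).
Proof.
move=> ekm degw inc f.
have incE e : incident e w = (e == ek) || (e == ord_max).
  by have /setP/(_ e) := inc; rewrite !inE.
rewrite cross1; have := incE f; rewrite /incident.
case: (boolP ((f == ek) || (f == ord_max))) => [fe|]; last first.
  by rewrite negb_or => /andP[/negPf-> /negPf->]; case: (_ == w); case: (_ == w).
pose other := if f == ek then ord_max else ek.
have other_neq : other != f.
  by rewrite /other; case: (eqVneq f ek) fe => [->|_] /=; rewrite eq_sym // eq_sym => /eqP->.
have io : incident other w.
  by rewrite incE /other; case: ifP; rewrite eqxx ?orbT.
move: degw; rewrite /degree (bigD1 f) //= (bigD1 other) //=.
move: io; rewrite /incident; set n := (\sum_(i | _) _)%N.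
have -> : (f == ek) (+) (f == ord_max).
  by case: (eqVneq f ek) fe => [->|_] //= _; rewrite (negPf ekm).
by do 4!case: (_ == w).
Qed.

Theorem theorem3p2 (q : nat) (G : ograph q.+1) (w : vertex G) (ek : 'I_q.+1) :
  block G ->
  standard G ->
  (ek : nat).+1 = corank G ->
  ek != ord_max ->
  degree w = 2 ->
  [set e : 'I_q.+1 | incident e w] = [set ek; ord_max] ->
  [/\ standard (delete_last G),
      standard (contract_last G)
    & has_NBC_basis (delete_last G) ->
      has_NBC_basis (contract_last G) ->
      has_NBC_basis G].
Proof.
move=> _ stdG corankG ekm degw inc.
have crw := cross_degree2 ekm degw inc.
have ekq : (ek < q)%N.
  by rewrite ltn_neqAle -ltnS ltn_ord andbT; apply: contra ekm => /eqP e; apply/eqP/val_inj.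
have ekE : ek = widen_ord (leqnSn q) (Ordinal ekq) by apply/val_inj.
rewrite ekE in corankG crw.
split.
- exact: (standard_delete stdG (esym corankG) crw).
- exact: (standard_contract stdG (esym corankG) crw).
- exact: (series_NBC_basis stdG (esym corankG) crw).
Qed.
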